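(* Let $2\le n<\omega$, $n<m\le\omega$, and let $\mathfrak{A}$ be an atomic $\mathsf{CA}_n$. If $\mathfrak{A}\in S_c\mathrm{Nr}_n\mathsf{CA}_m$, then player $\exists$ has a winning strategy in the game $F^m(\mathrm{At}\,\mathfrak{A})$. In particular, if $\mathfrak{A}$ is countable and completely representable, then $\exists$ has a winning strategy in $F^\omega(\mathrm{At}\,\mathfrak{A})$.
   Context: An atomic network over an atomic $\mathsf{CA}_n$ $\mathfrak A$ is a map $N:{}^n\Delta\to\mathrm{At}\,\mathfrak A$ ($\Delta=\mathrm{nodes}(N)$) such that for all $i,j<n$, $\delta\in{}^n\Delta$, $d\in\Delta$: $N(\delta^i_j)\le\mathsf d_{ij}$ (where $\delta^i_j$ is $\delta$ with $i$-th entry replaced by $\delta_j$) and $N(\delta[i\to d])\le\mathsf c_iN(\delta)$. The game $F^m(\mathrm{At}\,\mathfrak A)$ has $\omega$ rounds; players build networks whose node sets are finite subsets of $m$. In round $0$, $\forall$ picks an atom $a$ and $\exists$ must play a finite network $N_0$ with $\mathrm{nodes}(N_0)\subseteq m$ and $N_0(\bar d)=a$ for some $\bar d$. In a later round $\forall$ picks a previously played network $N$, an index $l<n$, a tuple $f_0,\dots,f_{n-2}\in\mathrm{nodes}(N)$, a node $k\in m\setminus\{f_0,\dots,f_{n-2}\}$ (possibly already a node of $N$), and an atom $b\le\mathsf c_lN(f_0,\dots,f_{l-1},x,f_l,\dots,f_{n-2})$ (any $x\in\mathrm{nodes}(N)$); $\exists$ must respond with a network $M$ with $\mathrm{nodes}(M)=\mathrm{nodes}(N)\cup\{k\}$,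 agreeing with $N$ on all tuples not involving $k$, and with $M(f_0,\dots,f_{l-1},k,f_l,\dots,f_{n-2})=b$. $\exists$ wins if she can always respond legally. $S_c$ is closure under complete subalgebras; $\mathrm{Nr}_n$ is neat reduct. *)

(* Defs.v *)
From mathcomp Require Import all_boot.
Set Implicit Arguments. Unset Strict Implicit. Unset Printing Implicit Defensive.

Inductive dimension := Fin (k : nat) | Omega.

Definition lt_dim (i : nat) (a : dimension) : Prop :=
  match a with Fin k => i < k | Omega => True end.

(* Cylindric algebra of dimension alpha.  Cylindrifications and diagonals are
   indexed by nat; only indices i < alpha are meaningful (axioms and all
   notions below only refer to those). *)
Record CA (alpha : dimension) := {
  car :> Type;
  add : car -> car -> car;
  mul : car -> car -> car;
  compl : car -> car;
  zero : car;
  one : car;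
  cyl : nat -> car -> car;
  diag : nat -> nat -> car;
  add_comm : forall x y, add x y = add y x;
  mul_comm : forall x y, mul x y = mul y x;
  add_assoc : forall x y z, add x (add y z) = add (add x y) z;
  mul_assoc : forall x y z, mul x (mul y z) = mul (mul x y) z;
  add_absorb : forall x y, add x (mul x y) = x;
  mul_absorb : forall x y, mul x (add x y) = x;
  add_distr : forall x y z, add x (mul y z) = mul (add x y) (add x z);
  mul_distr : forall x y z, mul x (add y z) = add (mul x y) (mul x z);
  add_zero : forall x, add x zero = x;
  mul_one : forall x, mul x one = x;
  add_compl : forall x, add x (compl x) = one;
  mul_compl : forall x, mul x (compl x) = zero;
  ca_C1 : forall i, lt_dim i alpha -> cyl i zero = zero;
  ca_C2 : forall i x, lt_dim i alpha -> add x (cyl i x) = cyl i x;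
  ca_C3 : forall i x y, lt_dim i alpha ->
            cyl i (mul x (cyl i y)) = mul (cyl i x) (cyl i y);
  ca_C4 : forall i j x, lt_dim i alpha -> lt_dim j alpha ->
            cyl i (cyl j x) = cyl j (cyl i x);
  ca_C5 : forall i, lt_dim i alpha -> diag i i = one;
  ca_C6 : forall i j k, lt_dim i alpha -> lt_dim j alpha -> lt_dim k alpha ->
            k <> i -> k <> j -> diag i j = cyl k (mul (diag i k) (diag k j));
  ca_C7 : forall i j x, lt_dim i alpha -> lt_dim j alpha -> i <> j ->
            mul (cyl i (mul (diag i j) x)) (cyl i (mul (diag i j) (compl x))) = zero
}.

Arguments add {alpha} c _ _.
Arguments mul {alpha} c _ _.
Arguments compl {alpha} c _.
Arguments zero {alpha} c.
Arguments one {alpha} c.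
Arguments cyl {alpha} c _ _.
Arguments diag {alpha} c _ _.

Section Basic.
Variables (alpha : dimension) (A : CA alpha).

Definition le (x y : A) : Prop := add A x y = y.

Definition atom (x : A) : Prop :=
  x <> zero A /\ forall y, le y x -> y = zero A \/ y = x.

Definition atomic : Prop :=
  forall x, x <> zero A -> exists a, atom a /\ le a x.

Definition is_ub (X : A -> Prop) (u : A) : Prop := forall x, X x -> le x u.

Definition is_sup (X : A -> Prop) (s : A) : Prop :=
  is_ub X s /\ forall u, is_ub X u -> le s u.

Definition is_sup_in (P : A -> Prop) (X : A -> Prop) (s : A) : Prop :=
  P s /\ is_ub X s /\ forall u, P u -> is_ub X u -> le s u.

Definition countable : Prop := exists f : A -> nat, forall x y, f x = f y -> x = y.
End Basic.

Definition in_Nr (n : nat) (m : dimension) (B : CA m) (x : B) : Prop :=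
  forall i, n <= i -> lt_dim i m -> cyl B i x = x.
Arguments in_Nr n {m} B x.

(* A in S_c Nr_n CA_m : A is isomorphic (via f) to a complete subalgebra of
   the neat reduct Nr_n B of some B in CA_m.  Completeness: every subset X of
   A with sum 1 in A is mapped to a set with sum 1 in Nr_n B. *)
Definition ScNr (n : nat) (m : dimension) (A : CA (Fin n)) : Prop :=
  exists (B : CA m) (f : A -> B),
    (forall x y, f x = f y -> x = y) /\
    (forall x, in_Nr n B (f x)) /\
    (forall x y, f (add A x y) = add B (f x) (f y)) /\
    (forall x y, f (mul A x y) = mul B (f x) (f y)) /\
    (forall x, f (compl A x) = compl B (f x)) /\
    f (zero A) = zero B /\ f (one A) = one B /\
    (forall i x, i < n -> f (cyl A i x) = cyl B i (f x)) /\
    (forall i j, i < n -> j < n -> f (diag A i j) = diag B i j) /\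
    (forall X : A -> Prop, is_sup X (one A) ->
       is_sup_in (in_Nr n B) (fun y => exists x, X x /\ y = f x) (one B)).

Arguments ScNr n m A : clear implicits.

Section Networks.
Variables (n : nat) (A : CA (Fin n)).

(* a (candidate) network: a finite node set and a labelling of n-tuples
   (n-tuples of nodes are sequences of length n) *)
Record network := Network { nodes : seq nat; lab : seq nat -> A }.

Definition tuple_in (D : seq nat) (s : seq nat) : Prop :=
  size s = n /\ forall z, z \in s -> z \in D.

(* atomic network: N : ^n Delta -> At A with the two coherence conditions;
   set_nth 0 d i (nth 0 d j) is delta^i_j, set_nth 0 d i e is delta[i -> e] *)
Definition is_network (N : network) : Prop :=
  forall d, tuple_in (nodes N) d ->
    atom (lab N d) /\
    (forall i j, i < n -> j < n ->
       le (lab N (set_nth 0 d i (nth 0 d j))) (diag A i j)) /\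
    (forall i e, i < n -> e \in nodes N ->
       le (lab N (set_nth 0 d i e)) (cyl A i (lab N d))).

Definition dflt_net : network := Network [::] (fun _ => zero A).

Inductive amove :=
| AStart of A
| AStep of nat & nat & seq nat & nat & A.
  (* AStep t l f k b : previously played network number t, index l,
     tuple f = (f_0,...,f_{n-2}), node k, atom b *)

Definition ins (l : nat) (f : seq nat) (x : nat) : seq nat :=
  take l f ++ x :: drop l f.

Variable m : dimension.

Definition legal_amove (prev : seq network) (mv : amove) : Prop :=
  match mv with
  | AStart a => prev = [::] /\ atom a
  | AStep t l f k b =>
      t < size prev /\
      let N := nth dflt_net prev t in
      l < n /\ size f = n.-1 /\ (forall z, z \in f -> z \in nodes N) /\
      k \notin f /\ lt_dim k m /\ atom b /\
      exists x, x \in nodes N /\ le b (cyl A l (lab N (ins l f x)))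
  end.

Definition legal_response (prev : seq network) (mv : amove) (M : network) : Prop :=
  is_network M /\ (forall z, z \in nodes M -> lt_dim z m) /\
  match mv with
  | AStart a => exists d, tuple_in (nodes M) d /\ lab M d = a
  | AStep t l f k b =>
      let N := nth dflt_net prev t in
      (forall z, z \in nodes M <-> z \in nodes N \/ z = k) /\
      (forall d, tuple_in (nodes N) d -> k \notin d -> lab M d = lab N d) /\
      lab M (ins l f k) = b
  end.

(* a strategy for exists maps the sequence of forall's moves so far
   (including the current one) to a network *)
Definition strategy := seq amove -> network.

Definition played (sigma : strategy) (h : seq amove) : seq network :=
  [seq sigma (take i.+1 h) | i <- iota 0 (size h)].

Definition legal_hist (sigma : strategy) (h : seq amove) : Prop :=
  forall r, r < size h ->
    legal_amove (played sigma (take r h)) (nth (AStart (zero A)) h r).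

Definition winning (sigma : strategy) : Prop :=
  forall h mv, legal_hist sigma h -> legal_amove (played sigma h) mv ->
    legal_response (played sigma h) mv (sigma (rcons h mv)).

Definition exists_wins_F : Prop := exists sigma, winning sigma.
End Networks.

Definition upd (n : nat) (U : Type) (s : 'I_n -> U) (i : 'I_n) (u : U) : 'I_n -> U :=
  fun j => if j == i then u else s j.

(* A complete representation of A on a generalized cartesian space
   V = union of disjoint ^n U_k (U_k the classes of the equivalence E on U),
   i.e. V = { s | all entries of s are E-related }. *)
Definition completely_representable (n : nat) (A : CA (Fin n)) : Prop :=
  exists (U : Type) (E : U -> U -> Prop) (h : A -> ('I_n -> U) -> Prop),
    let V := fun s : 'I_n -> U => forall i j, E (s i) (s j) in
    (forall u, E u u) /\ (forall u v, E u v -> E v u) /\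
    (forall u v w, E u v -> E v w -> E u w) /\
    (forall x s, h x s -> V s) /\
    (forall x y s, h (add A x y) s <-> h x s \/ h y s) /\
    (forall x y s, h (mul A x y) s <-> h x s /\ h y s) /\
    (forall x s, h (compl A x) s <-> V s /\ ~ h x s) /\
    (forall s, ~ h (zero A) s) /\
    (forall s, h (one A) s <-> V s) /\
    (forall (i : 'I_n) x s, h (cyl A i x) s <-> V s /\ exists u, h x (upd s i u)) /\
    (forall (i j : 'I_n) s, h (diag A i j) s <-> V s /\ s i = s j) /\
    (forall x y, (forall s, h x s <-> h y s) -> x = y) /\
    (forall (X : A -> Prop) x, is_sup X x ->
       forall s, h x s <-> exists y, X y /\ h y s).

(* Main.v *)
From Stdlib Require Import Classical ClassicalEpsilon FunctionalExtensionality.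
From mathcomp Require Import all_boot.
Require Import Defs.
Set Implicit Arguments. Unset Strict Implicit. Unset Printing Implicit Defensive.

(** Let [f] embed [A] in [Nr_n B]. A network [N] played by the second player is kept
    together with a nonzero [z : B] below all the elements [s_d (f (N d))], where
    [s_d] substitutes the tuple [d] of dimensions of [B] for [0, ..., n-1]. When
    the node [k] is to be reassigned, [c_k z] keeps what was said about the tuples
    avoiding [k] and meets [s_d (f b)] for the new tuple [d]; the remaining labels
    are found because, [f] being complete, the elements [s_d (f a)], [a] an atom,
    are dense below every nonzero element of finite dimension. (Working below
    elements of finite dimension replaces passing to the subalgebra of [B]
    generated by [A] when [m] is infinite.)

    The delicate point is that [s_d] is only a product of replacements
    [x |-> c_a (d_ab * x)], chosen once for each [d]: if [m = n + 1] its value does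
    depend on the choice. Coherence of the labels only requires that [s_d y]
    depends only on the entries [d_i], [i <> l], when [c_l y = y]. Such a [y]
    leaves two dimensions free, and then all products inducing the same renaming
    agree: think of the dimensions [y] depends on as tokens that are moved between
    slots, two of which stay free.

    From a complete representation the second player instead reads the labels off
    an assignment of points to the nodes. *)

(** * Boolean and cylindric laws, and the replacement operators *)

Section CylindricAlgebra.
Variables (alpha : dimension) (B : CA alpha).
Implicit Types (x y z u : B) (i j k a b c h : nat).

Local Notation "x *' y" := (mul B x y) (at level 40, left associativity).
Local Notation "'-' x" := (compl B x).
Local Notation "0" := (zero B).
Local Notation "1" := (one B).
Local Notation dim i := (lt_dim i alpha).

Lemma mulxx x : x *' x = x.
Proof. by rewrite -{2}(add_absorb x x) mul_absorb. Qed.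

Lemma one_mul x : 1 *' x = x.
Proof. by rewrite mul_comm mul_one. Qed.

Lemma mul_zero x : x *' 0 = 0.
Proof. by rewrite -(mul_compl x) mul_assoc mulxx. Qed.

Lemma leE x y : le x y <-> x *' y = x.
Proof.
split=> [<-|h]; first by rewrite mul_absorb.
by rewrite /le -{1}h add_comm mul_comm add_absorb.
Qed.

Lemma le_refl x : le x x.
Proof. by apply/leE/mulxx. Qed.

Lemma le_trans y x z : le x y -> le y z -> le x z.
Proof. by move=> /leE h1 /leE h2; apply/leE; rewrite -h1 -mul_assoc h2. Qed.

Lemma le_antisym x y : le x y -> le y x -> x = y.
Proof. by move=> /leE h1 /leE h2; rewrite -h1 mul_comm. Qed.

Lemma le_mull x y : le (x *' y) x.
Proof. by apply/leE; rewrite mul_comm mul_assoc mulxx. Qed.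

Lemma le_mulr x y : le (x *' y) y.
Proof. by rewrite mul_comm; apply: le_mull. Qed.

Lemma le_mul x y z : le x y -> le x z -> le x (y *' z).
Proof. by move=> /leE h1 /leE h2; apply/leE; rewrite mul_assoc h1. Qed.

Lemma le_mul2 x y z u : le x z -> le y u -> le (x *' y) (z *' u).
Proof.
by move=> h1 h2; apply: le_mul; [apply: le_trans h1 | apply: le_trans h2];
  [apply: le_mull | apply: le_mulr].
Qed.

Lemma le_zero x : le x 0 -> x = 0.
Proof. by move=> /leE <-; rewrite mul_zero. Qed.

Lemma le_compl x y : le x y <-> x *' - y = 0.
Proof.
split=> [/leE <-|h]; first by rewrite -mul_assoc mul_compl mul_zero.
by apply/leE; rewrite -{2}(mul_one x) -(add_compl y) mul_distr h add_zero.
Qed.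

Lemma complK x : - - x = x.
Proof.
apply: le_antisym; first by apply/le_compl; rewrite mul_comm mul_compl.
apply/leE; rewrite -[RHS]mul_one -(add_compl (- x)) mul_distr mul_compl.
by rewrite add_comm add_zero.
Qed.

Lemma le_compl_disjoint x y : x *' y = 0 -> le x (- y).
Proof. by move=> h; apply/le_compl; rewrite complK. Qed.

Lemma atom_le_or_disjoint x y : atom x -> le x y \/ x *' y = 0.
Proof.
by case=> _ /(_ _ (le_mull x y)) [->|/leE h]; [right|left].
Qed.

Lemma atoms_meet_eq x y : atom x -> atom y -> x *' y <> 0 -> x = y.
Proof.
move=> ax ay h.
have [lxy|//] := atom_le_or_disjoint y ax.
by case: ay => _ /(_ _ lxy) [x0|//]; case: ax => /(_ x0).
Qed.

Lemma cyl_ge i x : dim i -> le x (cyl B i x).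
Proof. exact: ca_C2. Qed.

Lemma cyl1 i : dim i -> cyl B i 1 = 1.
Proof.
move=> di; apply: le_antisym; last exact: cyl_ge.
by apply/leE; rewrite mul_one.
Qed.

Lemma cyl_idem i x : dim i -> cyl B i (cyl B i x) = cyl B i x.
Proof. by move=> di; rewrite -{1}(one_mul (cyl B i x)) ca_C3 // cyl1 // one_mul. Qed.

Lemma cyl_mono i x y : dim i -> le x y -> le (cyl B i x) (cyl B i y).
Proof.
move=> di l; have /leE <- : le x (cyl B i y) by apply: le_trans l _; apply: cyl_ge.
by rewrite ca_C3 //; apply: le_mulr.
Qed.

Lemma cyl_mul_fixr i x y : dim i -> cyl B i y = y -> cyl B i (x *' y) = cyl B i x *' y.
Proof. by move=> di h; rewrite -{1}h ca_C3 // h. Qed.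

Lemma cyl_mul_fixl i x y : dim i -> cyl B i x = x -> cyl B i (x *' y) = x *' cyl B i y.
Proof. by move=> di h; rewrite mul_comm cyl_mul_fixr // mul_comm. Qed.

Lemma cyl_mul_fix i x y : dim i -> cyl B i x = x -> cyl B i y = y ->
  cyl B i (x *' y) = x *' y.
Proof. by move=> di hx hy; rewrite cyl_mul_fixr ?hx. Qed.

Lemma cyl_eq0 i x : dim i -> cyl B i x = 0 -> x = 0.
Proof. by move=> di h; apply: le_zero; rewrite -h; apply: cyl_ge. Qed.

Lemma cyl_compl_fix i x : dim i -> cyl B i x = x -> cyl B i (- x) = - x.
Proof.
move=> di h; apply: le_antisym; last exact: cyl_ge.
by apply: le_compl_disjoint; rewrite -cyl_mul_fixr // mul_comm mul_compl ca_C1.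
Qed.

Lemma cyl_fix_cyl i j x : dim i -> dim j -> cyl B i x = x ->
  cyl B i (cyl B j x) = cyl B j x.
Proof. by move=> di dj h; rewrite ca_C4 // h. Qed.

(** Cylindrification is self-conjugate: by [ca_C3] a cylinder of either side is the product of both
    cylinders, and a cylinder vanishes only if its base does. *)
Lemma cyl_disjoint i x y : dim i -> cyl B i x *' y = 0 <-> x *' cyl B i y = 0.
Proof.
move=> di; split=> h; apply: (cyl_eq0 di).
- by rewrite ca_C3 // -cyl_mul_fixl ?cyl_idem // h ca_C1.
- by rewrite cyl_mul_fixl ?cyl_idem // -ca_C3 // h ca_C1.
Qed.

(** [ca_C6] writes [diag j j], which is 1, as the cylinder of [diag j i * diag i j]; by [ca_C7] the
    cylinder of the part of [diag i j] outside [diag j i] is then zero. *)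
Lemma diag_sym a b : dim a -> dim b -> diag B a b = diag B b a.
Proof.
suff le_ab i j : dim i -> dim j -> i <> j -> le (diag B i j) (diag B j i).
  move=> da db; case: (eqVneq a b) => [->//|/eqP ne].
  by apply: le_antisym; apply: le_ab => // /esym.
move=> di dj ne; apply/le_compl/(cyl_eq0 di).
rewrite -(one_mul (cyl _ _ _)) -(ca_C5 B dj) (@ca_C6 _ B j j i) //.
by rewrite (mul_comm (diag B j i)) ca_C7.
Qed.

Lemma cyl_diag1 a b : dim a -> dim b -> a <> b -> cyl B a (diag B a b) = 1.
Proof.
move=> da db ne; apply: le_antisym; first by apply/leE; rewrite mul_one.
rewrite -{1}(ca_C5 B db) (@ca_C6 _ B b b a) //.
by apply: cyl_mono => //; apply: le_mulr.
Qed.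

Lemma cyl_diag_fix i a b : dim i -> dim a -> dim b -> i <> a -> i <> b ->
  cyl B i (diag B a b) = diag B a b.
Proof. by move=> di da db na nb; rewrite (@ca_C6 _ B a b i) // cyl_idem. Qed.

(** By [ca_C7] the cylinder of the diagonal part of [x] is disjoint from that of its complement, so
    coming back to the diagonal adds nothing outside [x]. *)
Lemma diag_cyl_diag a b x : dim a -> dim b -> a <> b ->
  diag B a b *' cyl B a (diag B a b *' x) = diag B a b *' x.
Proof.
move=> da db ne; apply: le_antisym; last first.
  by apply: le_mul; [apply: le_mull | apply: cyl_ge].
apply: le_mul; first exact: le_mull.
apply/le_compl/le_zero; rewrite -(@ca_C7 _ B a b x) //.
rewrite (mul_comm (diag B a b)) -mul_assoc.
by apply: le_mul2; [apply: le_refl | apply: cyl_ge].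
Qed.

(** The substitution operator usually written s^a_b: the content of slot [a] is moved to slot [b].
    For [a = b] the formula degenerates to [cyl a], hence the condition [a <> b] throughout. *)
Definition subst a b x : B := cyl B a (diag B a b *' x).

(** On the diagonal, one factor may be exchanged for its cylinder by [diag_cyl_diag]; [ca_C3] then
    splits the product. *)
Lemma subst_mul a b x y : dim a -> dim b -> a <> b ->
  subst a b (x *' y) = subst a b x *' subst a b y.
Proof.
move=> da db ne; rewrite /subst -ca_C3 // (mul_comm (diag B a b) x) -(mul_assoc x).
by rewrite diag_cyl_diag // !mul_assoc (mul_comm x).
Qed.

Lemma subst0 a b : dim a -> subst a b 0 = 0.
Proof. by move=> da; rewrite /subst mul_zero ca_C1. Qed.

Lemma subst_fix a b x : dim a -> dim b -> a <> b -> cyl B a x = x -> subst a b x = x.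
Proof. by move=> da db ne h; rewrite /subst cyl_mul_fixr // cyl_diag1 // one_mul. Qed.

Lemma cyl_subst_same a b x : dim a -> cyl B a (subst a b x) = subst a b x.
Proof. exact: cyl_idem. Qed.

Lemma cyl_subst i a b x : dim i -> dim a -> dim b -> i <> a -> i <> b ->
  cyl B i (subst a b x) = subst a b (cyl B i x).
Proof. by move=> di da db na nb; rewrite /subst ca_C4 // cyl_mul_fixl ?cyl_diag_fix. Qed.

Lemma cyl_subst_target a b x : dim a -> dim b -> a <> b -> cyl B b x = x ->
  cyl B b (subst a b x) = subst a b (cyl B a x).
Proof.
move=> da db ne h; rewrite [RHS]subst_fix ?cyl_idem // /subst ca_C4 //.
rewrite cyl_mul_fixr // diag_sym // cyl_diag1 ?one_mul //.
by move=> e; apply: ne.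
Qed.

Lemma substK a b x : dim a -> dim b -> a <> b -> cyl B b x = x ->
  subst b a (subst a b x) = x.
Proof.
move=> da db ne h; rewrite /subst (@diag_sym b a) // diag_cyl_diag //.
rewrite cyl_mul_fixr // diag_sym // cyl_diag1 ?one_mul //.
by move=> e; apply: ne.
Qed.

(** The intermediate slot [b] is empty, so cylindrifying it composes [diag a b] and [diag b c] into
    [diag a c] by [ca_C6]. *)
Lemma subst_comp a b c x : dim a -> dim b -> dim c -> a <> b -> b <> c -> a <> c ->
  cyl B b x = x -> subst b c (subst a b x) = subst a c x.
Proof.
move=> da db dc ab bc ac h; rewrite /subst -cyl_mul_fixl ?cyl_diag_fix //.
rewrite ca_C4 // mul_assoc cyl_mul_fixr // (mul_comm (diag B b c)) -ca_C6 //.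
by move=> e; apply: ab.
Qed.

Lemma subst_comm a b c d x : dim a -> dim b -> dim c -> dim d ->
  a <> c -> a <> d -> c <> b -> subst a b (subst c d x) = subst c d (subst a b x).
Proof.
move=> da db dc dd ac ad cb; rewrite /subst.
have ca : c <> a by move=> e; apply: ac.
rewrite -cyl_mul_fixl ?cyl_diag_fix // -[in RHS]cyl_mul_fixl ?cyl_diag_fix //.
by rewrite ca_C4 // !mul_assoc (mul_comm (diag B a b)).
Qed.

Definition ren (p : nat * nat) i := if i == p.1 then p.2 else i.

Lemma subst_diag a b i j : dim a -> dim b -> dim i -> dim j -> a <> b ->
  subst a b (diag B i j) = diag B (ren (a, b) i) (ren (a, b) j).
Proof.
move=> da db di dj ne; rewrite /subst /ren /=.
case: (eqVneq i a) => [ia|/eqP ia]; case: (eqVneq j a) => [ja|/eqP ja].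
- by subst i j; rewrite !ca_C5 // mul_one cyl_diag1.
- by subst i; rewrite (diag_sym da db) -ca_C6 // => e; apply: ja.
- by subst j; rewrite mul_comm -ca_C6 // => e; apply: ia.
- by rewrite cyl_mul_fixr ?cyl_diag1 ?one_mul // cyl_diag_fix // => e; [apply: ia|apply: ja].
Qed.

Lemma subst_disjoint a b x z : dim a -> dim b ->
  subst a b x *' z = 0 <-> x *' (diag B a b *' cyl B a z) = 0.
Proof.
by move=> da db; rewrite /subst mul_assoc (mul_comm x); apply: cyl_disjoint.
Qed.

Lemma diag_cyl_neq0 a b z : dim a -> dim b -> a <> b -> z <> 0 ->
  diag B a b *' cyl B a z <> 0.
Proof.
move=> da db ne nz /(congr1 (cyl B a)); rewrite ca_C3 // cyl_diag1 // one_mul ca_C1 //.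
by move/cyl_eq0 => /(_ da).
Qed.

Lemma diag_subst a b x : dim a -> dim b -> a <> b ->
  diag B a b *' subst a b x = diag B a b *' x.
Proof. exact: diag_cyl_diag. Qed.

End CylindricAlgebra.

(** * Words of replacements acting on slots and on elements *)

Section SubstitutionWords.
Variables (alpha : dimension) (B : CA alpha).
Implicit Types (x y z u : B) (i j k a b c h : nat) (I P Q S : seq nat).
Implicit Types (w : seq (nat * nat)).

Local Notation dim i := (lt_dim i alpha).

(** The leftmost letter acts first, here and in [word_subst], so that tokens and elements move in
    step. *)
Definition word_ren w i := foldl (fun i p => ren p i) i w.
Definition word_subst w x := foldl (fun x p => subst p.1 p.2 x) x w.

Definition word_over I w := all (fun p => [&& p.1 != p.2, p.1 \in I & p.2 \in I]) w.
(** Dependence is controlled only inside the finite stock [I] of slots, which is enough because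
    words over [I] touch no other slot. *)
Definition supported I S x := forall i, i \in I -> i \notin S -> cyl B i x = x.

Lemma word_ren_rcons w p i : word_ren (rcons w p) i = ren p (word_ren w i).
Proof. exact: foldl_rcons. Qed.
Lemma word_subst_rcons w p x :
  word_subst (rcons w p) x = subst p.1 p.2 (word_subst w x).
Proof. exact: foldl_rcons. Qed.
Lemma word_ren_cat w w' i : word_ren (w ++ w') i = word_ren w' (word_ren w i).
Proof. exact: foldl_cat. Qed.
Lemma word_subst_cat w w' x : word_subst (w ++ w') x = word_subst w' (word_subst w x).
Proof. exact: foldl_cat. Qed.

Lemma sub_word_over I J w : {subset I <= J} -> word_over I w -> word_over J w.
Proof.
move=> IJ; apply: sub_all => p /and3P [-> h1 h2].
by rewrite !IJ.
Qed.

Lemma word_ren_notin a I w : a \notin I -> word_over I w -> word_ren w a = a.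
Proof.
move=> aI; elim: w => [//|[j k] w IH] /= /andP [/and3P [_ jI kI] hw].
rewrite /word_ren /= /ren /=; case: eqP => [e|_]; last exact: IH.
by rewrite e jI in aI.
Qed.

Lemma fresh (I S : seq nat) : uniq I -> size S < size I ->
  exists2 h, h \in I & h \notin S.
Proof.
move=> uI lt; have [/hasP //|/hasPn nh] := boolP (has (fun h => h \notin S) I).
have : {subset I <= S} by move=> i /nh; rewrite negbK.
by move/(uniq_leq_size uI); rewrite leqNgt lt.
Qed.

Variable I : seq nat.
Hypothesis dimI : forall i, i \in I -> dim i.

Lemma word_ren_in w i : word_over I w -> i \in I -> word_ren w i \in I.
Proof.
elim: w i => [//|[j k] w IH] i /= /andP [/and3P [_ jI kI] hw] iI.
by apply: IH => //; rewrite /ren /=; case: eqP.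
Qed.

Lemma supported_subst a b S x : a \in I -> b \in I -> a <> b ->
  supported I S x -> supported I (map (ren (a, b)) S) (subst a b x).
Proof.
move=> aI bI ne sx i iI iS.
have [->|/eqP ia] := eqVneq i a; first by apply: cyl_subst_same; apply: dimI.
have iS' : i \notin S.
  apply: contra iS => iS; apply/mapP; exists i => //.
  by rewrite /ren /=; case: eqP.
have [ib|/eqP ib] := eqVneq i b; last by rewrite cyl_subst ?sx //; apply: dimI.
(* Since [b] is missing from the image of [S], the slot [a] is empty and the replacement is the
   identity. *)
have aS : a \notin S.
  apply: contra iS => aS; apply/mapP; exists a => //.
  by rewrite /ren /= eqxx.
rewrite subst_fix; [exact: sx | exact: dimI | exact: dimI | exact: ne | exact: sx].
Qed.

Lemma supported_word w S x : word_over I w ->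
  supported I S x -> supported I (map (word_ren w) S) (word_subst w x).
Proof.
elim: w S x => [|[j k] w IH] S x /=; first by rewrite map_id_in.
move=> /andP [/and3P [/eqP ne jI kI] hw] sx.
have := IH (map (ren (j, k)) S) (subst j k x) hw (supported_subst jI kI ne sx).
by rewrite -map_comp.
Qed.

Lemma eq_supported S S' x : S =i S' -> supported I S x -> supported I S' x.
Proof. by move=> e sx i iI; rewrite -e; apply: sx. Qed.

Lemma word_subst_mul w x y : word_over I w ->
  word_subst w (mul B x y) = mul B (word_subst w x) (word_subst w y).
Proof.
elim: w x y => [//|[j k] w IH] x y /= /andP [/and3P [/eqP ne jI kI] hw].
by rewrite /word_subst /= subst_mul; [exact: IH|exact: dimI|exact: dimI|].
Qed.

Lemma word_subst0 w : word_over I w -> word_subst w (zero B) = zero B.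
Proof.
elim: w => [//|[j k] w IH] /= /andP [/and3P [/eqP ne jI kI] hw].
by rewrite /word_subst /= subst0; [exact: IH|exact: dimI].
Qed.

Lemma word_subst_diag w i j : word_over I w -> i \in I -> j \in I ->
  word_subst w (diag B i j) = diag B (word_ren w i) (word_ren w j).
Proof.
elim: w i j => [//|[a b] w IH] i j /= /andP [/and3P [/eqP ne aI bI] hw] iI jI.
rewrite /word_subst /= subst_diag //; try exact: dimI.
by apply: IH => //; rewrite /ren /=; case: eqP.
Qed.

(** Both ends of [diag i j] land in one slot, so the word sends it to 1; and on [diag i j] the
    elements [x] and [subst i j x] agree. *)
Lemma word_subst_merge w i j x : word_over I w -> i \in I -> j \in I -> i <> j ->
  word_ren w i = word_ren w j -> word_subst w (subst i j x) = word_subst w x.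
Proof.
move=> hw iI jI ne e.
have d1 : word_subst w (diag B i j) = one B.
  by rewrite word_subst_diag // e ca_C5 //; apply/dimI/word_ren_in.
rewrite -[LHS]one_mul -d1 -word_subst_mul // diag_subst //; try exact: dimI.
by rewrite word_subst_mul // d1 one_mul.
Qed.

(* The image of [z] under the transposition of the slots [a] and [b], computed
   with the help of a slot [h] on which [z] does not depend. *)
Definition transp a b h z := subst h a (subst a b (subst b h z)).

Lemma transp_free a b h z : dim a -> dim b -> dim h -> h <> a -> h <> b -> a <> b ->
  cyl B b z = z -> cyl B h z = z -> transp a b h z = subst a b z.
Proof.
move=> da db dh ha hb ab fb fh; rewrite /transp (subst_fix db dh _ fb); last congruence.
by rewrite subst_fix // cyl_subst ?fh.
Qed.

(** Route the token of [b] to [h] through [h']; the letter from [h'] to [h] commutes past the move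
    of [a] and is absorbed by the final move. *)
Lemma transp_indep a b h h' z : dim a -> dim b -> dim h -> dim h' ->
  h <> a -> h <> b -> h' <> a -> h' <> b -> a <> b ->
  cyl B h z = z -> cyl B h' z = z -> transp a b h z = transp a b h' z.
Proof.
move=> da db dh dh' ha hb ha' hb' ab fh fh'.
have [->//|/eqP hh'] := eqVneq h h'; rewrite /transp.
rewrite -(@subst_comp _ B b h' h) //; try congruence.
rewrite (@subst_comm _ B a b h' h) //; try congruence.
rewrite subst_comp //; try congruence.
by rewrite !cyl_subst ?fh //; congruence.
Qed.

Lemma subst_transp_same a b h k z : dim a -> dim b -> dim h -> dim k ->
  h <> a -> h <> b -> a <> b -> k <> a -> k <> b -> k <> h ->
  cyl B k z = z -> subst b k (transp a b h z) = transp a k h (subst b k z).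
Proof.
move=> da db dh dk ha hb ab ka kb kh fk; rewrite /transp.
rewrite (@subst_comp _ B b k h) //; try congruence.
rewrite (@subst_comm _ B b k h a) //; try congruence.
rewrite (@subst_comp _ B a b k) //; try congruence.
exact: cyl_subst_same.
Qed.

Lemma subst_transp_disjoint a b h j k z : dim a -> dim b -> dim h -> dim j -> dim k ->
  j <> h -> j <> a -> j <> b -> k <> h -> k <> a -> k <> b ->
  subst j k (transp a b h z) = transp a b h (subst j k z).
Proof.
move=> da db dh dj dk jh ja jb kh ka kb; rewrite /transp.
rewrite (@subst_comm _ B j k h a) //; try congruence.
rewrite (@subst_comm _ B j k a b) //; try congruence.
by rewrite (@subst_comm _ B j k b h) //; congruence.
Qed.

Definition swap a b i := if i == a then b else if i == b then a else i.

(** [u] is [z] with slots [a] and [b] exchanged, [Q] being the occupied slots of [z] other than [a].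
    Quantifying over all free helpers [h] lets each use pick a convenient one; [b = a] is separate
    because [transp a a] is degenerate. *)
Definition transp_rel a b Q z u := (b = a -> u = z) /\
  (b <> a -> forall h, h \in I -> h <> a -> h <> b -> ~ h \in Q -> u = transp a b h z).

Lemma transp_relI a b Q z u h : a \in I -> b \in I -> b <> a -> supported I (a :: Q) z ->
  h \in I -> h <> a -> h <> b -> ~ h \in Q -> u = transp a b h z -> transp_rel a b Q z u.
Proof.
move=> aI bI ba sz hI ha hb hQ ->; split=> // _ h' h'I h'a h'b h'Q.
have fix_z i : i \in I -> i <> a -> ~ i \in Q -> cyl B i z = z.
  by move=> iI ia iQ; apply: sz => //; rewrite inE; apply/norP; split; [apply/eqP|apply/negP].
apply: transp_indep; try exact: dimI; try exact: fix_z; congruence.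
Qed.

(** [u] is the actual state, with the token [a] in slot [b], and [z] the state with that token kept
    at home; they differ by one transposition. A move in [u] from an occupied to an empty slot is
    copied in [z] by at most one letter avoiding [a], after which the states again differ by one
    transposition. *)
Lemma transp_step a b Q z u j k :
  uniq I -> (size Q).+3 <= size I -> a \in I -> b \in I -> j \in I -> k \in I -> j <> k ->
  ~ a \in Q -> supported I (a :: Q) z -> transp_rel a b Q z u ->
  j \in b :: map (swap a b) Q -> k \notin b :: map (swap a b) Q ->
  exists w, [/\ word_over (filter (predC1 a) I) w,
    forall q, q \in Q -> word_ren w q = swap a (ren (j, k) b) (ren (j, k) (swap a b q)) &
    transp_rel a (ren (j, k) b) (map (word_ren w) Q) (word_subst w z) (subst j k u)].
Proof.
move=> uI sI aI bI jI kI jk aQ sz [relE relN] jC kC.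
have fix_z i : i \in I -> i <> a -> ~ i \in Q -> cyl B i z = z.
  by move=> iI ia iQ; apply: sz => //; rewrite inE; apply/norP; split; [apply/eqP|apply/negP].
have freshQ c : exists h, [/\ h \in I, h <> a, h <> c & ~ h \in Q].
  have [|h hI] := @fresh I [:: a, c & Q] uI; first by [].
  rewrite !inE => /norP [/eqP h1 /norP [/eqP h2 /negP h3]].
  by exists h.
have over1 i l : i \in I -> l \in I -> i <> l -> i <> a -> l <> a ->
  word_over (filter (predC1 a) I) [:: (i, l)].
  by move=> iI lI /eqP il /eqP ia /eqP la; rewrite /= !mem_filter /= il ia la iI lI.
have supp1 i l : i \in I -> l \in I -> i <> l -> i <> a ->
  supported I (a :: map (word_ren [:: (i, l)]) Q) (subst i l z).
  move=> iI lI il ia; have := supported_subst iI lI il sz.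
  by rewrite /= {1}/ren /=; case: eqP => // e; case: ia.
have kb : k <> b by move=> e; rewrite e inE eqxx in kC.
have kQ q : q \in Q -> k <> swap a b q.
  by move=> qQ e; move: kC; rewrite inE e map_f ?orbT.
have neQ i q : ~ i \in Q -> q \in Q -> q <> i by move=> h1 h2 e; rewrite -e in h1.
have Qa q : q \in Q -> q <> a by move=> qQ e; rewrite -e in aQ.
have im1 i l h : h <> l -> ~ h \in Q -> ~ h \in map (word_ren [:: (i, l)]) Q.
  move=> hl hQ /mapP [q qQ]; rewrite /word_ren /= /ren /=; case: eqP => // _ e.
  by rewrite e in hQ.
have im2 i l : i <> l -> ~ i \in map (word_ren [:: (i, l)]) Q.
  move=> il /mapP [q qQ]; rewrite /word_ren /= /ren /=; case: eqP => // ne e.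
  by case: ne.
(* First the moves of the held token itself. *)
have [jb|/eqP jb] := eqVneq j b.
  have renb : ren (j, k) b = k by rewrite /ren /= jb eqxx.
  rewrite renb; subst j.
  (* It comes home: the transposition is undone and [z] stays as it is. *)
  have [ka|/eqP ka] := eqVneq k a.
    subst k.
    have bQ : ~ b \in Q by move=> bQ; apply: (kQ b bQ); rewrite /swap eqxx; case: eqP.
    exists [::]; split=> //.
      move=> q qQ; have := Qa _ qQ; have := neQ _ _ bQ qQ.
      by rewrite /swap /ren /=; repeat (case: eqP => //=); congruence.
    rewrite map_id_in //; split=> // _.
    have [h [hI ha hb hQ]] := freshQ b.
    rewrite (relN jk h) // transp_free ?fix_z //; try exact: dimI; try congruence.
    by rewrite substK ?fix_z //; try exact: dimI; congruence.
  have kQ' : ~ k \in Q.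
    by move=> /[dup] kQ' /kQ; rewrite /swap; repeat case: eqP => //.
  (* It leaves home: a transposition with [k] appears, again without moving [z]. *)
  have [ba|/eqP ba] := eqVneq b a.
    exists [::]; split=> //.
      move=> q qQ; have := Qa _ qQ; have := neQ _ _ kQ' qQ.
      by rewrite /swap /ren /=; repeat (case: eqP => //=); congruence.
    rewrite map_id_in // ba in relE *; rewrite relE //.
    have [h [hI ha hb hQ]] := freshQ k.
    apply: (transp_relI aI kI ka sz hI ha hb hQ).
    by rewrite transp_free ?fix_z //; try exact: dimI; congruence.
  (* A token in slot [b] of [z] sits in slot [a] of [u]; shifting it to [k] in [z] keeps it there
     under [swap a k]. *)
  exists [:: (b, k)]; split; first by apply: over1.
    move=> q qQ; have := Qa _ qQ; have := neQ _ _ kQ' qQ.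
    by rewrite /word_ren /= /swap /ren /=; repeat (case: eqP => //=); congruence.
  have [bQ|/negP bQ] := boolP (b \in Q).
    have [h [hI ha hk hQ]] := freshQ k.
    have hb : h <> b by move=> e; rewrite e in hQ.
    apply: (transp_relI aI kI ka (supp1 _ _ bI kI _ _) hI ha hk) => //; first exact: im1.
    rewrite (relN ba h) // subst_transp_same ?fix_z //; try exact: dimI; congruence.
  rewrite /word_subst /=.
  have [h [hI ha hk hQ]] := freshQ b.
  apply: (transp_relI aI kI ka (supp1 _ _ bI kI _ _) bI) => //; try congruence.
    exact: im2.
  rewrite (relN ba h) // transp_free ?fix_z //; try exact: dimI; try congruence.
  rewrite subst_comp ?fix_z //; try exact: dimI; try congruence.
  rewrite (@subst_fix _ B b k) ?fix_z //; try exact: dimI; try congruence.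
  by rewrite transp_free ?fix_z //; try exact: dimI; congruence.
have renb : ren (j, k) b = b by rewrite /ren /=; case: eqP => // e; case: jb.
rewrite renb.
have {}jC : exists2 q, q \in Q & j = swap a b q.
  by move: jC; rewrite inE => /orP [/eqP //|/mapP].
(* The token leaving slot [a] of [u] is the one in slot [b] of [z]. *)
have [ja|/eqP ja] := eqVneq j a.
  subst j; have ba : b <> a by congruence.
  have bQ : b \in Q.
    case: jC => q qQ; rewrite /swap; case: eqP => [_ e|qa]; first by congruence.
    by case: eqP => [<-//|_ e]; case: qa.
  have ka : k <> a by congruence.
  have kQ' : ~ k \in Q.
    by move=> /[dup] kQ' /kQ; rewrite /swap; repeat case: eqP => //.
  exists [:: (b, k)]; split; first by apply: over1 => //; congruence.
    move=> q qQ; have := Qa _ qQ; have := neQ _ _ kQ' qQ.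
    by rewrite /word_ren /= /swap /ren /=; repeat (case: eqP => //=); congruence.
  have [h [hI ha hk hQ]] := freshQ k.
  have hb : h <> b by move=> e; rewrite e in hQ.
  apply: (transp_relI aI bI ba (supp1 _ _ bI kI _ _) hI ha) => //; try congruence.
    exact: im1.
  rewrite (relN ba k) // /transp substK //; try exact: dimI.
    rewrite /word_subst /= -/(transp a b h (subst b k z)) transp_free //;
      try exact: dimI; try congruence.
      by apply: cyl_subst_same; apply: dimI.
    by rewrite cyl_subst ?fix_z //; exact: dimI.
  by apply: cyl_subst_same; apply: dimI.
have jQ : j \in Q.
  case: jC => q qQ; rewrite /swap; case: eqP => [_ e|qa]; first by congruence.
  by case: eqP => [_ e|_ ->]; first by congruence.
(* Entering slot [a] of [u] means entering slot [b] of [z]. *)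
have [ka|/eqP ka] := eqVneq k a.
  subst k; have ba : b <> a by congruence.
  have bQ : ~ b \in Q by move=> bQ; apply: (kQ b bQ); rewrite /swap eqxx; case: eqP.
  exists [:: (j, b)]; split; first by apply: over1.
    move=> q qQ; have := Qa _ qQ; have := neQ _ _ bQ qQ.
    by rewrite /word_ren /= /swap /ren /=; repeat (case: eqP => //=); congruence.
  apply: (transp_relI aI bI ba (supp1 _ _ jI bI _ _) jI) => //; first exact: im2.
  have [h [hI ha hb hQ]] := freshQ b.
  rewrite (relN ba h) // transp_free ?fix_z //; try exact: dimI; try congruence.
  by rewrite /transp /word_subst /= substK ?fix_z //; exact: dimI.
have kQ' : ~ k \in Q.
  by move=> /[dup] kQ' /kQ; rewrite /swap; repeat case: eqP => //.
exists [:: (j, k)]; split; first by apply: over1.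
  move=> q qQ; have := Qa _ qQ; have := neQ _ _ kQ' qQ.
  by rewrite /word_ren /= /swap /ren /=; repeat (case: eqP => //=); congruence.
have [ba|/eqP ba] := eqVneq b a; first by split=> // _; rewrite relE.
have [bQ|/negP bQ] := boolP (b \in Q).
  have [h [hI ha hk hQ]] := freshQ k.
  have hb : h <> b by move=> e; rewrite e in hQ.
  have hj : j <> h by move=> e; rewrite -e in hQ.
  apply: (transp_relI aI bI ba (supp1 _ _ jI kI _ _) hI ha) => //; first exact: im1.
  rewrite (relN ba h) // subst_transp_disjoint //; try exact: dimI; congruence.
apply: (transp_relI aI bI ba (supp1 _ _ jI kI _ _) jI) => //; first exact: im2.
have [h [hI ha hb hQ]] := freshQ b.
rewrite (relN ba h) // transp_free ?fix_z //; try exact: dimI; try congruence.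
rewrite transp_free //; try exact: dimI.
- by rewrite subst_comm //; try exact: dimI; congruence.
- by congruence.
- by rewrite cyl_subst ?fix_z //; try exact: dimI; congruence.
- by apply: cyl_subst_same; apply: dimI.
Qed.

Lemma swapK a b : involutive (swap a b).
Proof. by move=> i; rewrite /swap; repeat (case: eqP => //=); congruence. Qed.

(* The moves of the token [a] are postponed: the other tokens are moved by a
   word [w'] that leaves the slot [a] alone, and what remains is one transposition. *)
Lemma hold_token a P y w : uniq I -> (size P).+3 <= size I -> a \in I ->
  {subset P <= I} -> ~ a \in P -> supported I (a :: P) y -> word_over I w ->
  {in a :: P &, injective (word_ren w)} ->
  exists w', [/\ word_over (filter (predC1 a) I) w',
    forall p, p \in P -> word_ren w' p = swap a (word_ren w a) (word_ren w p) &
    transp_rel a (word_ren w a) (map (word_ren w') P) (word_subst w' y) (word_subst w y)].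
Proof.
move=> uI sI aI PI aP sy; elim/last_ind: w => [_ _|w [j k] IH].
  exists [::]; split=> // p pP; rewrite /word_ren /= /swap.
  by case: eqP => // e; rewrite -e in aP.
rewrite {1}/word_over all_rcons => /andP [/= /and3P [/eqP jk jI kI] hw] inj.
have [|w' [hw' ren' rel]] := IH hw.
  by move=> p q pP qP e; apply: inj => //; rewrite !word_ren_rcons e.
set b := word_ren w a in ren' rel *.
set Q := map (word_ren w') P in rel.
have bI : b \in I by apply: word_ren_in.
have swQ : map (swap a b) Q = map (word_ren w) P.
  by rewrite -map_comp; apply/eq_in_map => p pP /=; rewrite ren' // swapK.
(* A token in slot [a] of the held state would share slot [b] with the token [a], against
   injectivity. *)
have aQ : ~ a \in Q.
  move=> /mapP [p pP]; rewrite ren' // => e.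
  suff pa : p = a by rewrite -pa in aP.
  apply: inj; rewrite ?inE ?eqxx ?pP ?orbT // !word_ren_rcons -/b.
  congr (ren _ _); rewrite -(swapK a b (word_ren w p)) -e.
  by rewrite /swap eqxx.
have hwI : word_over I w' by apply: sub_word_over hw' => i; rewrite mem_filter => /andP [].
have sz : supported I (a :: Q) (word_subst w' y).
  have := supported_word hwI sy; rewrite /= (@word_ren_notin _ (filter (predC1 a) I)) //.
  by rewrite mem_filter /= eqxx.
have su : supported I (b :: map (word_ren w) P) (word_subst w y) := supported_word hw sy.
rewrite word_ren_rcons word_subst_rcons -/b.
(* A letter whose source slot is empty changes nothing. *)
have [jC|jC] := boolP (j \in b :: map (word_ren w) P); last first.
  have fixj i : i \in b :: map (word_ren w) P -> ren (j, k) i = i.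
    by rewrite /ren /=; case: eqP => // -> ji; rewrite ji in jC.
  exists w'; split=> //.
    by move=> p pP; rewrite word_ren_rcons !fixj ?ren' ?inE ?eqxx // map_f ?orbT.
  rewrite fixj ?inE ?eqxx //= subst_fix //; try exact: dimI.
  exact: su.
(* An occupied target would merge two tokens. *)
have kC : k \notin b :: map (word_ren w) P.
  apply/negP => kC.
  have /mapP [p pP jE] : j \in map (word_ren w) (a :: P) by [].
  have /mapP [q qP kE] : k \in map (word_ren w) (a :: P) by [].
  apply: jk; rewrite jE kE; congr word_ren; apply: inj => //.
  rewrite !word_ren_rcons -jE -kE /ren /= eqxx.
  by case: eqP.
rewrite -swQ in jC kC.
have sQ : (size Q).+3 <= size I by rewrite size_map.
have [w2 [hw2 ren2 rel2]] := transp_step uI sQ aI bI jI kI jk aQ sz rel jC kC.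
exists (w' ++ w2); split.
- by rewrite /word_over all_cat; apply/andP.
- move=> p pP; rewrite word_ren_cat word_ren_rcons ren2 ?map_f //.
  by rewrite ren' // swapK.
- rewrite word_subst_cat (eq_map (word_ren_cat w' w2)).
  by rewrite (map_comp (word_ren w2)).
Qed.

(** An injective word moves tokens only into empty slots, so its letters can be reversed from last
    to first; those with an empty source are dropped. *)
Lemma word_inverse P w : {subset P <= I} -> word_over I w -> {in P &, injective (word_ren w)} ->
  exists w', [/\ word_over I w', forall p, p \in P -> word_ren w' (word_ren w p) = p &
    forall z, supported I (map (word_ren w) P) z -> word_subst w (word_subst w' z) = z].
Proof.
elim: w P => [|[j k] w IH] P PI /=; first by exists [::].
move=> /andP [/and3P [/eqP jk jI kI] hw] inj.
have [||w' [hw' ren' sub']] := IH (map (ren (j, k)) P) _ hw.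
- by move=> i /mapP [p pP ->]; rewrite /ren /=; case: eqP => // _; apply: PI.
- move=> _ _ /mapP [p pP ->] /mapP [q qP ->] e.
  by congr ren; apply: inj.
have supp z : supported I (map (word_ren ((j, k) :: w)) P) z ->
    supported I (map (ren (j, k)) P) (word_subst w' z).
  rewrite (map_comp (word_ren w)) => sz; have := supported_word hw' sz.
  rewrite -map_comp map_id_in // => i iP; exact: ren'.
have free_j z : supported I (map (word_ren ((j, k) :: w)) P) z ->
    cyl B j (word_subst w' z) = word_subst w' z.
  move/supp; apply=> //; apply/mapP => -[p pP]; rewrite /ren /=.
  by case: eqP => // pj e; case: pj.
have sub_w z : supported I (map (word_ren ((j, k) :: w)) P) z ->
    word_subst w (word_subst w' z) = z.
  by move=> sz; apply: sub'; rewrite -map_comp.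
have [jP|jP] := boolP (j \in P); last first.
  exists w'; split=> //.
    move=> p pP; have /ren' : ren (j, k) p \in map (ren (j, k)) P by apply: map_f.
    rewrite /word_ren /= => ->; rewrite /ren /=; case: eqP => // e.
    by rewrite e (negbTE jP) in pP.
  move=> z sz; rewrite /word_subst /= subst_fix //; try exact: dimI.
    exact: sub_w.
  exact: free_j.
have kP : k \notin P.
  apply/negP => kP; apply: jk; apply: inj => //; congr word_ren.
  by rewrite /word_ren /= /ren /= eqxx; case: eqP.
exists (rcons w' (k, j)); split.
- rewrite /word_over all_rcons; apply/andP; split=> //=.
  by apply/and3P; split=> //; apply/eqP => e; apply: jk.
- move=> p pP; have /ren' : ren (j, k) p \in map (ren (j, k)) P by apply: map_f.
  rewrite word_ren_rcons /word_ren /= => ->; rewrite /ren /=.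
  case: (eqVneq p j) => [->|_]; first by rewrite eqxx.
  by case: eqP => // e; rewrite -e pP in kP.
- move=> z sz; rewrite word_subst_rcons /= /word_subst /= substK;
    [exact: sub_w| exact: dimI | exact: dimI | by move=> e; apply: jk | exact: free_j].
Qed.

End SubstitutionWords.

(** * With two free slots, a word acts through its renaming alone *)

Section Uniqueness.
Variables (alpha : dimension) (B : CA alpha).
Implicit Types (I P : seq nat) (y : B) (w : seq (nat * nat)).

Lemma word_subst_free I y w : (forall i, i \in I -> lt_dim i alpha) ->
  supported I [::] y -> word_over I w -> word_subst w y = y.
Proof.
move=> dimI sy; elim: w => [//|[j k] w IH] /= /andP [/and3P [/eqP jk jI kI] hw].
rewrite /word_subst /= subst_fix; [exact: IH| exact: dimI | exact: dimI| exact: jk |].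
exact: sy.
Qed.

(** Induction on the tokens. Since [a] returns home, the transposition left by [hold_token] is
    trivial, and what remains is a loop of the other tokens in the slots other than [a]; the number
    of free slots is unchanged. *)
Lemma word_loop I P y w : (forall i, i \in I -> lt_dim i alpha) -> uniq I -> uniq P ->
  (size P).+2 <= size I -> {subset P <= I} -> supported I P y -> word_over I w ->
  (forall p, p \in P -> word_ren w p = p) -> word_subst w y = y.
Proof.
elim: P I w => [|a P IH] I w dimI uI; first by move=> _ _ _ + + _; apply: word_subst_free.
move=> /= /andP [/negP aP uP] sI PI sy hw fixw.
have aI : a \in I by apply: PI; rewrite inE eqxx.
have PI' : {subset P <= I} by move=> p pP; apply: PI; rewrite inE pP orbT.
have [|w' [hw' ren' [+ _]]] := hold_token dimI uI sI aI PI' aP sy hw.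
  by move=> p q pP qP; rewrite !fixw.
have fa : word_ren w a = a by apply: fixw; rewrite inE eqxx.
rewrite fa in ren' * => ->//.
apply: (IH (filter (predC1 a) I)) => //.
- by move=> i; rewrite mem_filter => /andP [_]; apply: dimI.
- exact: filter_uniq.
- by rewrite -rem_filter // size_rem //; case: (size I) sI.
- move=> p pP; rewrite mem_filter PI' // andbT /=.
  by apply/eqP => e; rewrite -e in aP.
- move=> i; rewrite mem_filter => /andP [/= ia iI] iP; apply: sy => //.
  by rewrite inE (negbTE ia).
- move=> p pP; rewrite ren' // fixw ?inE ?pP ?orbT // /swap.
  by case: eqP => // e; rewrite -e in aP.
Qed.

(** [w1] followed by the inverse of [w2] is a loop; [w2] applied once more recovers its own
    value. *)
Lemma word_subst_unique_inj I P y w1 w2 : (forall i, i \in I -> lt_dim i alpha) ->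
  uniq I -> uniq P -> (size P).+2 <= size I -> {subset P <= I} -> supported I P y ->
  word_over I w1 -> word_over I w2 -> {in P, word_ren w1 =1 word_ren w2} ->
  {in P &, injective (word_ren w2)} -> word_subst w1 y = word_subst w2 y.
Proof.
move=> dimI uI uP sI PI sy hw1 hw2 e inj.
have [w3 [hw3 ren3 sub3]] := word_inverse B dimI PI hw2 inj.
have eP : map (word_ren w2) P = map (word_ren w1) P by apply/esym/eq_in_map.
rewrite -(sub3 (word_subst w1 y)); last by rewrite eP; apply: supported_word.
congr word_subst; rewrite -word_subst_cat.
apply: (word_loop dimI uI uP sI PI sy).
- by rewrite /word_over all_cat; apply/andP.
- by move=> p pP; rewrite word_ren_cat e // ren3.
Qed.

(* Two free slots are needed: with a single one the merry-go-round identities can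
   fail. *)
Lemma word_subst_unique I P y w1 w2 : (forall i, i \in I -> lt_dim i alpha) ->
  uniq I -> uniq P -> (size P).+2 <= size I -> {subset P <= I} -> supported I P y ->
  word_over I w1 -> word_over I w2 -> {in P, word_ren w1 =1 word_ren w2} ->
  word_subst w1 y = word_subst w2 y.
Proof.
move=> dimI uI + + + + hw1 hw2.
elim: {P}(size P) {-2}P (erefl (size P)) y => [|s IH] P sP y uP sI PI sy e.
  apply: (word_subst_unique_inj dimI uI uP) => // p.
  by rewrite (size0nil sP).
have [/allP inj|/allPn [p pP /allPn [q qP]]] :=
  boolP (all (fun p => all (fun q => (word_ren w2 p == word_ren w2 q) ==> (p == q)) P) P).
  apply: (word_subst_unique_inj dimI uI uP) => // p q pP qP /eqP epq.
  by move/allP: (inj p pP) => /(_ q qP); rewrite epq /= => /eqP.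
rewrite negb_imply => /andP [/eqP epq /eqP pq].
have pI := PI p pP; have qI := PI q qP.
(* Tokens [p] and [q] that end up together are merged beforehand, which removes [p] from the
   support. *)
rewrite -(word_subst_merge dimI y hw2 pI qI pq epq).
rewrite -(word_subst_merge dimI y hw1 pI qI pq); last by rewrite !e.
have sz : size (rem p P) = s by rewrite size_rem // sP.
have sub : {subset rem p P <= P} by apply: mem_rem.
apply: (IH (rem p P)) => //.
- exact: rem_uniq.
- by rewrite sz; rewrite sP in sI; apply: ltnW.
- by move=> i /sub /PI.
- have := supported_subst dimI pI qI pq sy; apply: eq_supported => i.
  apply/mapP/idP => [[r rP ->]|].
    rewrite mem_rem_uniq // inE /ren /=; case: (eqVneq r p) => rp; last by rewrite rp.
    by rewrite qP andbT; apply/eqP => e'; apply: pq.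
  rewrite mem_rem_uniq // inE => /andP [/= ip iP]; exists i => //.
  by rewrite /ren /= (negbTE ip).
- by move=> i /sub; apply: e.
Qed.

End Uniqueness.

(** * Strategies from invariants, and tuples of nodes *)

Section Game.
Variables (n : nat) (A : CA (Fin n)) (m : dimension).
Implicit Types (N M : network A) (h : seq (amove A)) (prev : seq (network A)).

(** A strategy sees only the opponent's moves, so the earlier networks are recomputed by folding a
    choice function along the history. The invariant is kept for all of them because any one may be
    picked again. *)
Lemma exists_wins_of_invariant (G : network A -> Prop) :
  (forall prev mv, (forall N, List.In N prev -> G N) -> legal_amove m prev mv ->
    exists M, G M /\ legal_response m prev mv M) ->
  exists_wins_F A m.
Proof.
move=> step.
pose choose prev mv := epsilon (inhabits (dflt_net A))
  (fun M => G M /\ legal_response m prev mv M).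
pose nets := foldl (fun prev mv => rcons prev (choose prev mv)) [::].
pose sigma h := last (dflt_net A) (nets h).
have nets_rcons h mv : nets (rcons h mv) = rcons (nets h) (choose (nets h) mv).
  by rewrite /nets foldl_rcons.
have playedE h : played sigma h = nets h.
  elim/last_ind: h => [//|h mv IH].
  rewrite nets_rcons -IH /played size_rcons -addn1 iotaD map_cat /= cats1.
  congr rcons; last by rewrite add0n take_oversize ?size_rcons // /sigma nets_rcons last_rcons -IH.
  apply/eq_in_map => i; rewrite mem_iota => /andP [_ lt].
  by rewrite -cats1 takel_cat.
have chooseP prev mv : (forall N, List.In N prev -> G N) -> legal_amove m prev mv ->
    G (choose prev mv) /\ legal_response m prev mv (choose prev mv).
  by move=> Gp lg; exact: (epsilon_spec (inhabits (dflt_net A)) _ (step _ _ Gp lg)).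
have good h : legal_hist m sigma h -> forall N, List.In N (nets h) -> G N.
  elim/last_ind: h => [//|h mv IH] lg.
  have lgh : legal_hist m sigma h.
    move=> r lt; have := lg r; rewrite size_rcons nth_rcons lt -cats1.
    by rewrite takel_cat; [apply; rewrite ltnS ltnW | exact: ltnW].
  have lgm : legal_amove m (nets h) mv.
    have := lg (size h); rewrite size_rcons nth_rcons ltnn eqxx -cats1 take_size_cat //.
    by rewrite playedE; apply.
  move=> N; rewrite nets_rcons -cats1 => inN.
  case: (List.in_app_or _ _ _ inN) => [inN'|[<-|//]]; first exact: IH inN'.
  by case: (chooseP _ _ (IH lgh) lgm).
exists sigma => h mv lg; rewrite playedE => lgm.
rewrite /sigma nets_rcons last_rcons.
by case: (chooseP _ _ (good _ lg) lgm).
Qed.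

Lemma In_nth_net prev t : t < size prev -> List.In (nth (dflt_net A) prev t) prev.
Proof. by elim: prev t => [//|N p IH] [|t] lt; [left|right; apply: IH]. Qed.

Lemma atomic_sup1 : atomic A -> is_sup (@atom _ A) (one A).
Proof.
move=> atA; split=> [x _|u ub]; first by apply/leE; rewrite mul_one.
apply: NNPP => nle; have := atA (compl A u); case=> [e|a [aa le_a]].
  by apply: nle; apply/le_compl; rewrite e mul_zero.
case: (aa) => a0 _; apply: a0; apply: le_zero.
by rewrite -(mul_compl u); apply: le_mul => //; apply: ub.
Qed.

(** An atom [a] not below [cyl l b] is disjoint from it, and by self-conjugacy [cyl l a] is then
    disjoint from [b]. *)
Lemma atom_cyl_sym l (a b : A) : l < n -> atom a -> atom b ->
  le b (cyl A l a) -> le a (cyl A l b).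
Proof.
move=> ln aa [b0 _] le_b; have [//|e] := atom_le_or_disjoint (cyl A l b) aa.
case: b0; apply: le_zero; move/leE: le_b => <-.
by move/(@cyl_disjoint _ A l a b ln): e; rewrite mul_comm => ->; apply: le_refl.
Qed.

Lemma tuple_in_set_nth D d i e : i < n -> e \in D -> tuple_in n D d ->
  tuple_in n D (set_nth 0 d i e).
Proof.
move=> ln eD [sd dD]; have ss : size (set_nth 0 d i e) = n.
  by rewrite size_set_nth sd; apply/maxn_idPr.
split=> // z /(nthP 0) [k]; rewrite ss nth_set_nth /= => lk <-.
by case: eqP => // _; apply: dD; apply: mem_nth; rewrite sd.
Qed.

Lemma tuple_in_nth D d i : i < n -> tuple_in n D d -> nth 0 d i \in D.
Proof. by move=> ln [sd dD]; apply: dD; apply: mem_nth; rewrite sd. Qed.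

Lemma size_ins l f x : l < n -> size f = n.-1 -> size (ins l f x) = n.
Proof.
move=> ln sf; rewrite size_cat /= addnS -size_cat cat_take_drop sf.
by case: n ln.
Qed.

Lemma nth_ins l f x i : l < n -> size f = n.-1 ->
  nth 0 (ins l f x) i = if i < l then nth 0 f i else if i == l then x else nth 0 f i.-1.
Proof.
move=> ln sf; have lf : l <= size f by rewrite sf; case: n ln.
rewrite nth_cat size_takel //; case: ltnP => [lt|le]; first by rewrite nth_take.
case: eqP => [->|/eqP ne]; first by rewrite subnn.
have {}le : l < i by rewrite ltn_neqAle eq_sym ne.
by rewrite -(subnSK le) /= nth_drop; case: i le {ne} => //= i; rewrite subSS => le; rewrite subnKC.
Qed.

Lemma mem_ins l f x : ins l f x =i x :: f.
Proof. by move=> i; rewrite mem_cat !inE orbCA -mem_cat cat_take_drop. Qed.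

Lemma tuple_in_ins D l f x : l < n -> size f = n.-1 -> (forall z, z \in f -> z \in D) ->
  x \in D -> tuple_in n D (ins l f x).
Proof.
move=> ln sf fD xD; split; first exact: size_ins.
by move=> z; rewrite mem_ins inE => /orP [/eqP ->|/fD].
Qed.

Lemma nth_ins_neq l f k i : l < n -> size f = n.-1 -> k \notin f -> i < n -> i <> l ->
  nth 0 (ins l f k) i <> k.
Proof.
move=> ln sf kf lin /eqP ne e; move: kf; rewrite -e nth_ins // (negbTE ne).
case: ltnP => lil; rewrite mem_nth // sf.
  by apply: leq_trans lil _; case: n ln.
have : l < i by rewrite ltn_neqAle eq_sym ne.
by case: i lin {ne e lil} => // i /= + _; case: n.
Qed.
End Game.

(** * The strategy read off a complete representation *)

Section CompleteRepresentation.
Variables (n : nat) (A : CA (Fin n)).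
Hypotheses (n2 : 2 <= n) (atA : atomic A).

Lemma completely_representable_wins : completely_representable A -> exists_wins_F A Omega.
Proof.
case=> U [E [h []]] /= Er [Es [Et [hV [_ [hM [_ [h0 [h1 [hC [hD [hI hS]]]]]]]]]]].
have n0 : 0 < n by apply: ltnW.
pose pt (v : nat -> U) d := fun i : 'I_n => v (nth 0 d i).
pose Evs (v : nat -> U) (D : seq nat) := forall p q, p \in D -> q \in D -> E (v p) (v q).
have ptV v D d : Evs v D -> tuple_in n D d -> forall i j, E (pt v d i) (pt v d j).
  by move=> ev td i j; apply: ev; apply: tuple_in_nth.
pose label v d := epsilon (inhabits (zero A)) (fun a : A => atom a /\ h a (pt v d)).
have labP v D d : Evs v D -> tuple_in n D d -> atom (label v d) /\ h (label v d) (pt v d).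
  move=> ev td.
  (* The atoms have sum 1 and [h] preserves sums, so every point of the unit lies in the image of an
     atom. *)
  have ex : exists a, atom a /\ h a (pt v d).
    by apply/(hS _ _ (atomic_sup1 atA))/h1; apply: ptV td.
  exact: (epsilon_spec (inhabits (zero A)) _ ex).
have meet a b s : h a s -> h b s -> mul A a b <> zero A.
  by move=> ha hb e; apply: (h0 s); rewrite -e; apply/hM.
have uniq_at a b s : atom a -> atom b -> h a s -> h b s -> a = b.
  by move=> aa ab ha hb; apply: atoms_meet_eq => //; apply: meet ha hb.
have le_at a b s : atom a -> h a s -> h b s -> le a b.
  by move=> aa ha hb; case: (atom_le_or_disjoint b aa) => // /(meet _ _ _ ha hb).
have h_le a b s : le a b -> h a s -> h b s.
  by move=> /leE <- /hM [].
(* Invariant: the labels are read off a map sending all nodes into one class of [E]. *)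
pose G (N : network A) := exists v, Evs v (nodes N) /\
  forall d, tuple_in n (nodes N) d -> atom (lab N d) /\ h (lab N d) (pt v d).
have netP v D : Evs v D -> is_network (Network D (label v)).
  move=> ev d td; have [al hl] := labP v D d ev td.
  split=> //; split=> [i j li lj|i e li eD] /=.
    have td' := tuple_in_set_nth li (tuple_in_nth lj td) td.
    have [al' hl'] := labP v D _ ev td'; apply: (le_at _ _ _ al' hl').
    apply/(hD (Ordinal li) (Ordinal lj)); split; first exact: ptV td'.
    by rewrite /pt /= !nth_set_nth /= eqxx; case: eqP.
  have td' := tuple_in_set_nth li eD td.
  have [al' hl'] := labP v D _ ev td'; apply: (le_at _ _ _ al' hl').
  apply/(hC (Ordinal li)); split; first exact: ptV td'.
  exists (v (nth 0 d i)); suff -> : upd (pt v (set_nth 0 d i e)) (Ordinal li) (v (nth 0 d i)) = pt v d by [].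
  apply: functional_extensionality => j; rewrite /upd /pt nth_set_nth /=.
  by rewrite -(inj_eq val_inj) /=; case: eqP => // ->.
apply: (@exists_wins_of_invariant _ _ _ G) => prev [a|t l f k b] GP.
  case=> p0 aa; subst prev.
  have [s hs] : exists s, h a s.
    apply: NNPP => ns; case: (aa) => a0 _; apply: a0; apply: hI => s.
    by split=> [hs|/h0 //]; case: ns; exists s.
  (* The default of [insubd] is met only for [i >= n], outside the nodes. *)
  pose v i := s (insubd (Ordinal n0) i).
  have ev : Evs v (iota 0 n) by move=> p q _ _; apply: hV hs _ _.
  have td : tuple_in n (iota 0 n) (iota 0 n) by rewrite /tuple_in size_iota.
  exists (Network (iota 0 n) (label v)); split.
    by exists v; split=> // d td'; apply: labP td'.
  split; first exact: netP.
  split=> //; exists (iota 0 n); split=> //=.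
  have [al hl] := labP _ _ _ ev td; apply: (uniq_at _ _ _ al aa hl).
  suff -> : pt v (iota 0 n) = s by [].
  apply: functional_extensionality => i; rewrite /pt /v nth_iota // add0n; congr s.
  by apply: val_inj; rewrite val_insubd ltn_ord.
case=> lt; set N := nth _ prev t => -[ln [sf [fN [kf [_ [ab [x [xN le_b]]]]]]]].
have [v [ev gN]] : G N by apply: GP; apply: In_nth_net.
have tx := tuple_in_ins ln sf fN xN.
have [ax hx] := gN _ tx.
(* The old label lies below [cyl l b], which supplies the point [u] to be assigned to [k]. *)
have := h_le _ _ _ (atom_cyl_sym ln ax ab le_b) hx.
move/(hC (Ordinal ln)) => [_ [u hu]].
pose v' i := if i == k then u else v i.
have ptk : upd (pt v (ins l f x)) (Ordinal ln) u = pt v' (ins l f k).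
  apply: functional_extensionality => j; rewrite /upd /pt /v' -(inj_eq val_inj) /=.
  case: eqP => [->|jl]; first by rewrite !(nth_ins _ _ ln sf) ltnn !eqxx.
  case: eqP => [/(nth_ins_neq ln sf kf (ltn_ord j) jl) //|_].
  by congr v; rewrite !(nth_ins _ _ ln sf); case: ltnP => // _; case: eqP.
(* As [n >= 2], the tuple [f] is nonempty; its entry [y] ties [u] to the class of the old nodes. *)
have [y yf] : exists y, y \in f.
  case: (f) sf => [/esym/eqP|y f' _]; last by exists y; rewrite inE eqxx.
  by rewrite -leqn0 leqNgt; case: (n) n2 => [|[]].
have Euy : E u (v y).
  have ky : (y == k) = false by apply/eqP => e; rewrite -e yf in kf.
  have [i li iE] : exists2 i, i < n & nth 0 (ins l f k) i = y.
    have : y \in ins l f k by rewrite mem_ins inE yf orbT.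
    by move=> /(nthP 0) [i]; rewrite (size_ins _ ln sf); exists i.
  have := hV _ _ hu (Ordinal ln) (Ordinal li); rewrite ptk /pt /= iE /v' ky.
  by rewrite (nth_ins _ _ ln sf) ltnn !eqxx.
have ev' : Evs v' (k :: nodes N).
  have Eu p : p \in nodes N -> E u (v p) by move=> pN; apply: Et Euy _; apply: ev => //; apply: fN.
  move=> p q; rewrite !inE /v'; case: eqP => [_ _|_ /= pN]; case: eqP => [_ _|_ /= qN] //.
  - exact: Eu.
  - by apply/Es/Eu.
  - exact: ev.
have tk : tuple_in n (k :: nodes N) (ins l f k).
  by apply: tuple_in_ins; rewrite // ?inE ?eqxx // => z zf; rewrite inE fN ?orbT.
exists (Network (k :: nodes N) (label v')); split.
  by exists v'; split=> // d td; apply: labP td.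
split; first exact: netP.
split=> //=; split; last split.
- move=> z; rewrite inE; split=> [/orP [/eqP|]|[|->]]; [by right|by left| |by rewrite eqxx].
  by move=> ->; rewrite orbT.
- move=> d td kd; have [al hl] := gN _ td.
  have td' : tuple_in n (k :: nodes N) d.
    by case: td => sd dN; split=> // z /dN zN; rewrite inE zN orbT.
  have [al' hl'] := labP _ _ _ ev' td'; apply: (uniq_at _ _ _ al' al hl').
  suff -> : pt v' d = pt v d by [].
  apply: functional_extensionality => i; rewrite /pt /v'; case: eqP => // e.
  by move: kd; rewrite -e mem_nth //; case: td => ->.
- have [al hl] := labP _ _ _ ev' tk; apply: (uniq_at _ _ _ al ab hl).
  by rewrite -ptk.
Qed.
End CompleteRepresentation.

(** * Existence of words, their cylinders and conjugates, elements of finite dimension *)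

Section MoreWords.
Variables (alpha : dimension) (B : CA alpha).
Implicit Types (I S d : seq nat) (x y z : B) (w : seq (nat * nat)).

(** The tokens are brought to their targets one by one, with one spare slot for clearing the way. *)
Lemma word_exists n I d : uniq I -> {subset iota 0 n <= I} -> n < size I -> size d = n ->
  {subset d <= I} -> exists2 w, word_over I w & forall i, i < n -> word_ren w i = nth 0 d i.
Proof.
move=> uI nI sI sd dI.
have inI i : i < n -> i \in I by move=> li; apply: nI; rewrite mem_iota add0n.
(* The tokens [i < t] are in place and the remaining ones sit alone in their slots. *)
have main t : t <= n -> exists w, [/\ word_over I w,
    forall i, i < t -> word_ren w i = nth 0 d i &
    forall i j, i < n -> t <= j -> j < n -> word_ren w i = word_ren w j -> i = j].
  elim: t => [_|t IH lt]; first by exists [::].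
  have [w [hw ren_w alone]] := IH (ltnW lt).
  have ltn i : i < t -> i < n by move=> li; apply: ltn_trans lt.
  have slot_t i : i < n -> word_ren w i = word_ren w t -> i = t.
    by move=> li; apply: alone.
  set q := word_ren w t in slot_t; set e := nth 0 d t.
  have qI : q \in I by apply: word_ren_in => //; apply: inI.
  have eI : e \in I by apply: dI; apply: mem_nth; rewrite sd.
  have [qe|/eqP qe] := eqVneq q e.
    exists w; split=> // [i|i j li lj]; last exact: alone (ltnW lj).
    by rewrite ltnS leq_eqVlt => /orP [/eqP ->|/ren_w].
  have [/existsP [r /andP [ltr /eqP re]]|/existsPn free] :=
    boolP [exists r : 'I_n, (t < r) && (word_ren w r == e)].
    (* A token [r] still to be placed blocks the target [e]; it is first moved to an empty slot [h],
       which exists because [n < size I]. *)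
    have [|h hI hC] := @fresh I (map (word_ren w) (iota 0 n)) uI.
      by rewrite size_map size_iota.
    have nh i : i < n -> word_ren w i <> h.
      by move=> li E; case/mapP: hC; exists i; rewrite ?mem_iota ?add0n.
    have slot_r i : i < n -> word_ren w i = e -> i = r.
      by rewrite -re => li; apply: alone => //; apply: ltnW.
    have eh : e <> h by rewrite -re; apply: nh.
    have qh : q <> h by apply: nh.
    exists (w ++ [:: (e, h); (q, e)]).
    have renE i : word_ren (w ++ [:: (e, h); (q, e)]) i =
        if word_ren w i == e then h else if word_ren w i == q then e else word_ren w i.
      rewrite word_ren_cat /word_ren /= /ren /=; case: (eqVneq _ e) => [_|//].
      by case: eqP => // hq; case: qh.
    split.
    - rewrite /word_over all_cat; apply/andP; split=> //=; rewrite hI eI qI !andbT.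
      by apply/andP; split; apply/eqP.
    - move=> i; rewrite ltnS leq_eqVlt renE => /orP [/eqP ->|li].
        by rewrite -/q eqxx; case: eqP.
      case: eqP => [/(slot_r _ (ltn _ li)) ir|_]; first by rewrite ir ltnNge ltnW in li.
      case: eqP => [/(slot_t _ (ltn _ li)) it|_]; first by rewrite it ltnn in li.
      exact: ren_w.
    - move=> i j li lj ljn; rewrite !renE.
      have jt : word_ren w j <> q by move/(slot_t _ ljn) => jt; rewrite jt ltnn in lj.
      have := nh i li; have := nh j ljn.
      case: (eqVneq (word_ren w i) e) => [/(slot_r _ li) ->|/eqP ie];
        case: (eqVneq (word_ren w j) e) => [/(slot_r _ ljn) ->|/eqP je] //.
      - by case: eqP => // _ jh _ e'; case: jh.
      - by case: eqP.
      - case: eqP => // _; case: eqP => // _ _ _ e'; first by case: je.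
        exact: alone (ltnW lj) ljn e'.
  (* Only tokens already placed can sit at [e], and joining them is what [d] prescribes. *)
  exists (w ++ [:: (q, e)]).
  have renE i : word_ren (w ++ [:: (q, e)]) i =
      if word_ren w i == q then e else word_ren w i.
    by rewrite word_ren_cat.
  split.
  - rewrite /word_over all_cat; apply/andP; split=> //=; rewrite eI qI !andbT.
    exact/eqP.
  - move=> i; rewrite ltnS leq_eqVlt renE => /orP [/eqP ->|li]; first by rewrite -/q eqxx.
    case: eqP => [/(slot_t _ (ltn _ li)) it|_]; first by rewrite it ltnn in li.
    exact: ren_w.
  - move=> i j li lj ljn; rewrite !renE.
    have jt : word_ren w j <> q by move/(slot_t _ ljn) => jt; rewrite jt ltnn in lj.
    have je : word_ren w j <> e.
      by move=> je; have := free (Ordinal ljn); rewrite /= lj je eqxx.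
    case: (eqVneq (word_ren w j) q) => // _; case: eqP => [_ e'|_]; first by case: je.
    exact: alone (ltnW lj) ljn.
by have [w [hw ren_w _]] := main n (leqnn n); exists w.
Qed.

(** Letter by letter. A letter moving [l] enters an empty slot, since no other token may join [l];
    for the same reason a letter into the slot of [l] has an empty source and does nothing; every
    other letter commutes with the cylinder. *)
Lemma cyl_word_subst I l S x w : (forall i, i \in I -> lt_dim i alpha) -> l \in I ->
  supported I (l :: S) x -> word_over I w ->
  (forall q, q \in S -> word_ren w q <> word_ren w l) ->
  cyl B (word_ren w l) (word_subst w x) = word_subst w (cyl B l x).
Proof.
move=> dimI; elim: w l S x => [//|[j k] w IH] l S x lI sx /=.
move=> /andP [/and3P [/eqP jk jI kI] hw] sep.
have dj := dimI j jI; have dk := dimI k kI; have dl := dimI l lI.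
have r_in i : i \in I -> ren (j, k) i \in I by rewrite /ren /=; case: eqP.
have ren_sep q : q \in S -> ren (j, k) q <> ren (j, k) l.
  by move=> qS e; apply: (sep q qS); rewrite /word_ren /= e.
have e : cyl B (ren (j, k) l) (subst j k x) = subst j k (cyl B l x).
  rewrite {1}/ren /=; case: eqP => [e|/nesym jl].
    subst j; rewrite cyl_subst_target //; apply: sx => //.
    rewrite inE; apply/norP; split; first by apply/eqP => e; apply: jk.
    apply/negP => /ren_sep; rewrite /ren /= eqxx.
    by case: eqP => // e; case: jk.
  have [kl|/eqP kl] := eqVneq k l; last by rewrite cyl_subst //; congruence.
  subst k; have fj : cyl B j x = x.
    apply: sx => //; rewrite inE; apply/norP; split; first exact/eqP.
    by apply/negP => /ren_sep; rewrite /ren /= eqxx; case: eqP.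
  by rewrite (subst_fix dj dk jk fj) (subst_fix dj dk jk) // cyl_fix_cyl.
have := IH (ren (j, k) l) (map (ren (j, k)) S) (subst j k x) (r_in _ lI).
rewrite e; apply=> //; first exact: (supported_subst dimI jI kI jk sx).
by move=> _ /mapP [q qS ->]; apply: sep.
Qed.

(** Every element is of this kind when [m] is finite; the notion restricts something only for
    [Omega]. *)
Definition finitary x := exists K, forall i, K <= i -> lt_dim i alpha -> cyl B i x = x.

Lemma finitary_mul x y : finitary x -> finitary y -> finitary (mul B x y).
Proof.
move=> [K hK] [L hL]; exists (maxn K L) => i; rewrite geq_max => /andP [Ki Li] di.
by apply: cyl_mul_fix => //; [apply: hK|apply: hL].
Qed.

Lemma finitary_cyl j x : lt_dim j alpha -> finitary x -> finitary (cyl B j x).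
Proof. by move=> dj [K hK]; exists K => i Ki di; apply: cyl_fix_cyl => //; apply: hK. Qed.

Lemma finitary_diag a b : lt_dim a alpha -> lt_dim b alpha -> finitary (diag B a b).
Proof.
move=> da db; exists (maxn a b).+1 => i; rewrite gtn_max => /andP [ai bi] di.
by apply: cyl_diag_fix => // e; rewrite e ltnn in ai bi.
Qed.

Lemma finitary_word I w x : (forall i, i \in I -> lt_dim i alpha) -> word_over I w ->
  finitary x -> finitary (word_subst w x).
Proof.
move=> dimI; elim: w x => [//|[j k] w IH] x /= /andP [/and3P [_ jI kI] hw] fx.
apply: IH => //; apply: finitary_cyl; first exact: dimI.
by apply: finitary_mul => //; apply: finitary_diag; apply: dimI.
Qed.

(* [subst a b] has the conjugate [z |-> d_ab * c_a z], which preserves being nonzero. *)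
Lemma word_subst_conjugate I w z : (forall i, i \in I -> lt_dim i alpha) ->
  word_over I w -> z <> zero B -> finitary z ->
  exists z', [/\ z' <> zero B, finitary z' &
    forall x, mul B (word_subst w x) z = zero B -> mul B x z' = zero B].
Proof.
move=> dimI; elim: w => [|[j k] w IH] /=; first by exists z.
move=> /andP [/and3P [/eqP jk jI kI] hw] z0 fz.
have dj := dimI j jI; have dk := dimI k kI.
have [z' [z0' fz' conj]] := IH hw z0 fz.
exists (mul B (diag B j k) (cyl B j z')); split; first exact: diag_cyl_neq0.
  by apply: finitary_mul; [apply: finitary_diag | apply: finitary_cyl].
by move=> x /conj /subst_disjoint; apply.
Qed.
End MoreWords.

Lemma enum_tuples n (D : seq nat) : exists L : seq (seq nat),
  forall d, d \in L <-> tuple_in n D d.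
Proof.
elim: n => [|n [L hL]].
  exists [:: [::]] => d; rewrite inE; split=> [/eqP -> //|[/size0nil -> //]].
exists [seq x :: d | x <- D, d <- L] => d; split.
  move=> /allpairsP [[x d'] /= [xD /hL [sd dD] ->]]; split=> [|z]; first by rewrite /= sd.
  by rewrite inE => /orP [/eqP -> //|/dD].
case: d => [[]//|x d [[sd] dD]]; apply/allpairsP; exists (x, d) => /=; split=> //.
  by apply: dD; rewrite inE eqxx.
by apply/hL; split=> // z zd; apply: dD; rewrite inE zd orbT.
Qed.

Lemma lt_dim_trans i j m : i <= j -> lt_dim j m -> lt_dim i m.
Proof. by case: m => //= k; apply: leq_ltn_trans. Qed.

(** * The strategy read off a complete embedding in a neat reduct *)

Section NeatReduct.
Variables (n : nat) (m : dimension) (A : CA (Fin n)) (B : CA m) (f : A -> B).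
Hypotheses (nm : lt_dim n m) (atA : atomic A).
Hypothesis f_inj : forall x y, f x = f y -> x = y.
Hypothesis f_Nr : forall x, in_Nr n B (f x).
Hypothesis f_mul : forall x y, f (mul A x y) = mul B (f x) (f y).
Hypothesis f_zero : f (zero A) = zero B.
Hypothesis f_cyl : forall i x, i < n -> f (cyl A i x) = cyl B i (f x).
Hypothesis f_diag : forall i j, i < n -> j < n -> f (diag A i j) = diag B i j.
Hypothesis f_sup : forall X : A -> Prop, is_sup X (one A) ->
  is_sup_in (in_Nr n B) (fun y => exists x, X x /\ y = f x) (one B).
Implicit Types (d D : seq nat) (a b : A) (x y z : B).

Definition dimensions D := forall i, i \in D -> lt_dim i m.

Lemma dim_le_n i : i <= n -> lt_dim i m.
Proof. by move=> le; apply: lt_dim_trans nm. Qed.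

(** Completeness of the embedding enters here: otherwise the complement of [z] would be an upper
    bound in the neat reduct for the images of the atoms, whose sum is 1. *)
Lemma atoms_dense_Nr z : in_Nr n B z ->
  (forall a, atom a -> mul B (f a) z = zero B) -> z = zero B.
Proof.
move=> Nz az; have [_ [_ lub]] := f_sup (atomic_sup1 atA).
have le1 : le (one B) (compl B z).
  apply: lub => [i ni di|_ [a [aa ->]]]; first by apply: cyl_compl_fix => //; apply: Nz.
  by apply: le_compl_disjoint; apply: az.
by move/le_compl: le1; rewrite complK one_mul.
Qed.

(** The extra dimensions of [z] are cylindrified away from the top: [f a] does not depend on them,
    so disjointness persists, and a zero cylinder has a zero base. *)
Lemma atoms_dense z : finitary z ->
  (forall a, atom a -> mul B (f a) z = zero B) -> z = zero B.
Proof.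
case=> K; elim: K z => [|K IH] z fz az.
  by apply: atoms_dense_Nr => // i _; apply: fz.
have [Kn|nK] := ltnP K n.
  by apply: atoms_dense_Nr => // i ni; apply: fz; apply: leq_trans ni.
have [dK|dK] := classic (lt_dim K m).
  apply: (cyl_eq0 dK); apply: IH => [i Ki di|a aa].
    have [->|ne] := eqVneq i K; first exact: cyl_idem.
    by apply: cyl_fix_cyl => //; apply: fz => //; rewrite ltn_neqAle eq_sym ne.
  by rewrite -cyl_mul_fixl // ?az ?ca_C1 //; apply: f_Nr.
apply: IH => // i Ki di; apply: fz => //; rewrite ltn_neqAle Ki andbT.
by apply/eqP => e; rewrite -e in di.
Qed.

(** The last clause makes the identity tuple act as the identity, as the opening move requires; with
    a single spare slot, another word with the identity renaming might act differently. *)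
Definition word_for d w :=
  [/\ exists2 I, dimensions I & word_over I w,
      forall i, i < n -> word_ren w i = nth 0 d i &
      d = iota 0 n -> w = [::]].

Lemma word_for_exists d : size d = n -> dimensions d -> exists w, word_for d w.
Proof.
move=> sd dd; have [->|/eqP ne] := eqVneq d (iota 0 n).
  exists [::]; split=> [|i li|//]; first by exists [::].
  by rewrite nth_iota.
pose I := undup (iota 0 n.+1 ++ d).
have memI i : (i \in I) = (i < n.+1) || (i \in d).
  by rewrite mem_undup mem_cat mem_iota add0n.
have [|||||w hw renw] := @word_exists n I d.
- exact: undup_uniq.
- by move=> i; rewrite memI mem_iota add0n /= => li; rewrite ltnW.
- rewrite -[X in X <= _](size_iota 0 n.+1); apply: uniq_leq_size; first exact: iota_uniq.
  by move=> i; rewrite memI mem_iota add0n /= => ->.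
- by [].
- by move=> i; rewrite memI => ->; rewrite orbT.
exists w; split=> //; exists I => // i; rewrite memI => /orP [|/dd //].
exact: dim_le_n.
Qed.

Definition word_of d := epsilon (inhabits [::]) (word_for d).

Lemma word_ofP d : size d = n -> dimensions d -> word_for d (word_of d).
Proof. by move=> sd dd; exact: (epsilon_spec _ _ (word_for_exists sd dd)). Qed.

Definition at_tuple d x := word_subst (word_of d) x.

Definition valid d := size d = n /\ dimensions d.

(** The stock of slots can be enlarged at will: [iota 0 n.+1] provides the spare slot [n], and [D]
    makes room for a second word. *)
Lemma word_of_over d D : valid d -> dimensions D -> exists I,
  [/\ uniq I, dimensions I, {subset D <= I}, {subset iota 0 n.+1 <= I} &
      word_over I (word_of d)].
Proof.
move=> [sd dd] dD; have [[I dI hw] _ _] := word_ofP sd dd.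
have sub (J : seq nat) : {subset J <= iota 0 n.+1 ++ D ++ I} ->
    {subset J <= undup (iota 0 n.+1 ++ D ++ I)}.
  by move=> h i /h; rewrite mem_undup.
exists (undup (iota 0 n.+1 ++ D ++ I)); split.
- exact: undup_uniq.
- move=> i; rewrite mem_undup !mem_cat mem_iota add0n => /or3P [/andP [_]|/dD|/dI] //.
  exact: dim_le_n.
- by apply: sub => i iD; rewrite !mem_cat iD orbT.
- by apply: sub => i iD; rewrite !mem_cat iD.
- by apply: sub_word_over hw; apply: sub => i iD; rewrite !mem_cat iD !orbT.
Qed.

Lemma dimensions0 : dimensions [::].
Proof. by []. Qed.

Lemma word_of_ren d i : valid d -> i < n -> word_ren (word_of d) i = nth 0 d i.
Proof. by move=> [sd dd]; have [_ h _] := word_ofP sd dd; apply: h. Qed.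

Lemma at_tuple_mul d x y : valid d ->
  at_tuple d (mul B x y) = mul B (at_tuple d x) (at_tuple d y).
Proof.
by move=> vd; have [I [_ dI _ _ hw]] := word_of_over vd dimensions0; apply: word_subst_mul hw.
Qed.

Lemma at_tuple0 d : valid d -> at_tuple d (zero B) = zero B.
Proof.
by move=> vd; have [I [_ dI _ _ hw]] := word_of_over vd dimensions0; apply: word_subst0 hw.
Qed.

Lemma at_tuple_mono d x y : valid d -> le x y -> le (at_tuple d x) (at_tuple d y).
Proof. by move=> vd /leE h; apply/leE; rewrite -at_tuple_mul ?h. Qed.

Lemma at_tuple_diag d i j : valid d -> i < n -> j < n -> nth 0 d i = nth 0 d j ->
  at_tuple d (diag B i j) = one B.
Proof.
move=> vd li lj e; have [I [_ dI _ nI hw]] := word_of_over vd dimensions0.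
have inI k : k < n -> k \in I by move=> lk; apply: nI; rewrite mem_iota leq0n add0n ltnS ltnW.
rewrite /at_tuple (word_subst_diag B dI hw) ?inI // !word_of_ren // e ca_C5 //.
by case: vd => sd; apply; apply: mem_nth; rewrite sd.
Qed.

Lemma supported_Nr I x : dimensions I -> in_Nr n B x -> supported I (iota 0 n) x.
Proof.
by move=> dI Nx i iI; rewrite mem_iota add0n /= -leqNgt => ni; apply: Nx => //; apply: dI.
Qed.

Lemma cyl_at_tuple_notin d k x : valid d -> in_Nr n B x -> lt_dim k m -> k \notin d ->
  cyl B k (at_tuple d x) = at_tuple d x.
Proof.
move=> vd Nx dk kd; have dD : dimensions [:: k] by move=> i; rewrite inE => /eqP ->.
have [I [_ dI kI _ hw]] := word_of_over vd dD.
apply: (supported_word dI hw (supported_Nr dI Nx)); first by apply: kI; rewrite inE.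
apply: contra kd => /mapP [i]; rewrite mem_iota add0n => /andP [_ li] ->.
by rewrite word_of_ren // mem_nth //; case: vd => ->.
Qed.

Lemma cyl_at_tuple d l x : valid d -> in_Nr n B x -> l < n ->
  (forall i, i < n -> i <> l -> nth 0 d i <> nth 0 d l) ->
  cyl B (nth 0 d l) (at_tuple d x) = at_tuple d (cyl B l x).
Proof.
move=> vd Nx ln sep; have [I [_ dI _ nI hw]] := word_of_over vd dimensions0.
rewrite -(word_of_ren vd ln).
apply: (@cyl_word_subst _ _ I l (filter (predC1 l) (iota 0 n))) => //.
- by apply: nI; rewrite mem_iota leq0n add0n ltnS ltnW.
- apply: eq_supported (supported_Nr dI Nx) => i.
  rewrite inE mem_filter mem_iota add0n /=.
  by case: eqP => // ->; rewrite ln.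
- move=> q; rewrite mem_filter mem_iota add0n => /= /andP [/eqP ql lq].
  by rewrite !word_of_ren //; apply: sep.
Qed.

(* An element of [Nr_n B] that does not depend on [l] leaves two slots free
   (namely [l] and [n]), even when [m = n + 1]. *)
Lemma at_tuple_eq d d' l x : valid d -> valid d' -> in_Nr n B x -> l < n ->
  cyl B l x = x -> (forall i, i < n -> i <> l -> nth 0 d i = nth 0 d' i) ->
  at_tuple d x = at_tuple d' x.
Proof.
move=> vd vd' Nx ln fx e.
have [I' [_ dI' _ _ hw']] := word_of_over vd' dimensions0.
have [I [uI dI I'I nI hw]] := word_of_over vd dI'.
pose P := filter (predC1 l) (iota 0 n).
have uP : uniq P by rewrite filter_uniq ?iota_uniq.
have sP : size P = n.-1.
  by rewrite /P -rem_filter ?iota_uniq // size_rem ?size_iota // mem_iota add0n.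
apply: (@word_subst_unique _ _ I P) => //.
- have -> : (size P).+2 = size (iota 0 n.+1).
    by rewrite sP size_iota; case: (n) ln.
  by apply: uniq_leq_size => //; apply: iota_uniq.
- move=> i; rewrite mem_filter mem_iota add0n => /andP [_ li].
  by apply: nI; rewrite mem_iota leq0n add0n ltnS ltnW.
- move=> i iI; rewrite mem_filter mem_iota add0n /=; case: eqP => [->//|_] /=.
  by rewrite -leqNgt => ni; apply: Nx => //; apply: dI.
- exact: sub_word_over hw'.
- move=> i; rewrite mem_filter mem_iota add0n => /= /andP [/eqP il li].
  by rewrite !word_of_ren // e.
Qed.

(** The conjugate of the word carries [z] to a nonzero finitary [z'], where [atoms_dense]
    applies. *)
Lemma at_tuple_dense d z : valid d -> finitary z -> z <> zero B ->
  exists2 a, atom a & mul B (at_tuple d (f a)) z <> zero B.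
Proof.
move=> vd fz z0; have [I [_ dI _ _ hw]] := word_of_over vd dimensions0.
have [z' [z0' fz' conj]] := word_subst_conjugate dI hw z0 fz.
apply: NNPP => na; apply: z0'; apply: atoms_dense => // a aa.
by apply: conj; apply: NNPP => nz; apply: na; exists a.
Qed.

Lemma finitary_at_tuple d a : valid d -> finitary (at_tuple d (f a)).
Proof.
move=> vd; have [I [_ dI _ _ hw]] := word_of_over vd dimensions0.
by apply: finitary_word hw _ => //; exists n; apply: f_Nr.
Qed.

(** One tuple at a time: density gives an atom whose image meets the current element, and this meet
    becomes the next element. Earlier labels persist because the element only shrinks. *)
Lemma label_tuples (L : seq (seq nat)) z : (forall d, d \in L -> valid d) ->
  finitary z -> z <> zero B -> exists z' (lb : seq nat -> A),
  [/\ finitary z', z' <> zero B, le z' z &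
      forall d, d \in L -> atom (lb d) /\ le z' (at_tuple d (f (lb d)))].
Proof.
move=> + fz z0; elim: L => [_|d L IH vL].
  by exists z, (fun=> zero A); split=> //; apply: le_refl.
have [|z' [lb [fz' z0' le_z lbP]]] := IH.
  by move=> d' dL; apply: vL; rewrite inE dL orbT.
have vd : valid d by apply: vL; rewrite inE eqxx.
have [a aa ne] := at_tuple_dense vd fz' z0'.
exists (mul B (at_tuple d (f a)) z'), (fun d' => if d' == d then a else lb d'); split=> //.
- by apply: finitary_mul => //; apply: finitary_at_tuple.
- exact: le_trans (le_mulr _ _) le_z.
- move=> d'; rewrite inE; case: eqP => [-> _|_ /= dL]; first by split=> //; apply: le_mull.
  by have [al le'] := lbP _ dL; split=> //; apply: le_trans (le_mulr _ _) le'.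
Qed.

(** * Networks whose labels hold jointly below a nonzero element of [B] *)

Definition witnessed_by (z : B) (N : network A) :=
  forall d, tuple_in n (nodes N) d ->
    atom (lab N d) /\ le z (at_tuple d (f (lab N d))).

Definition witnessed (N : network A) :=
  dimensions (nodes N) /\
  exists z, [/\ finitary z, z <> zero B & witnessed_by z N].

Lemma valid_tuple D d : dimensions D -> tuple_in n D d -> valid d.
Proof. by move=> dD [sd dd]; split=> // i /dd /dD. Qed.

Lemma witnessed_exists D z : dimensions D -> finitary z -> z <> zero B ->
  exists lb z', [/\ finitary z', z' <> zero B, le z' z & witnessed_by z' (Network D lb)].
Proof.
move=> dD fz z0; have [L hL] := enum_tuples n D.
have [|z' [lb [fz' z0' le_z lbP]]] := @label_tuples L z _ fz z0.
  by move=> d /hL; apply: valid_tuple.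
by exists lb, z'; split=> // d td; apply: lbP; apply/hL.
Qed.

(** [at_tuple d] preserves products and zero, so disjoint labels would leave nothing for [z]. *)
Lemma meet_neq0 d z a b : valid d -> z <> zero B ->
  le z (at_tuple d (f a)) -> le z (at_tuple d (f b)) -> mul A a b <> zero A.
Proof.
move=> vd z0 ha hb e; apply: z0; apply: le_zero.
by rewrite -(at_tuple0 vd) -f_zero -e f_mul at_tuple_mul //; apply: le_mul.
Qed.

Lemma witnessed_label_le d z a b : valid d -> z <> zero B -> atom a ->
  le z (at_tuple d (f a)) -> le z (at_tuple d (f b)) -> le a b.
Proof.
by move=> vd z0 aa ha hb; case: (atom_le_or_disjoint b aa) => // /(meet_neq0 vd z0 ha hb).
Qed.

Lemma witnessed_label_eq d z a b : valid d -> z <> zero B -> atom a -> atom b ->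
  le z (at_tuple d (f a)) -> le z (at_tuple d (f b)) -> a = b.
Proof.
by move=> vd z0 aa ab ha hb; apply: atoms_meet_eq => //; apply: meet_neq0 ha hb.
Qed.

Lemma Nr_cyl l x : l < n -> in_Nr n B x -> in_Nr n B (cyl B l x).
Proof.
by move=> ln Nx i ni di; apply: cyl_fix_cyl => //; [apply/dim_le_n/ltnW|apply: Nx].
Qed.

Lemma witnessed_network N : witnessed N -> is_network N.
Proof.
move=> [dN [z [fz z0 wz]]] d td; have vd := valid_tuple dN td.
have [al hl] := wz d td; split=> //; split=> [i j li lj|i e li eN].
  have td' := tuple_in_set_nth li (tuple_in_nth lj td) td.
  have [al' hl'] := wz _ td'; have vd' := valid_tuple dN td'.
  apply: (witnessed_label_le vd' z0) => //.
  rewrite f_diag // at_tuple_diag //; first by apply/leE; rewrite mul_one.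
  by rewrite !nth_set_nth /= eqxx; case: eqP.
have td' := tuple_in_set_nth li eN td.
have [al' hl'] := wz _ td'; have vd' := valid_tuple dN td'.
have di : lt_dim i m by apply/dim_le_n/ltnW.
apply: (witnessed_label_le vd' z0) => //; rewrite f_cyl //.
(* The cylinder over [i] does not depend on entry [i], the only one in which the two tuples
   differ. *)
rewrite (@at_tuple_eq _ d i) //.
- by apply: le_trans hl _; apply: at_tuple_mono => //; apply: cyl_ge.
- exact: Nr_cyl.
- exact: cyl_idem.
- by move=> j _ ji; rewrite nth_set_nth /=; case: eqP.
Qed.

Lemma neat_reduct_wins : exists_wins_F A m.
Proof.
apply: (@exists_wins_of_invariant _ _ _ witnessed) => prev [a|t l g k b] wp.
  case=> p0 aa; subst prev.
  have dn : dimensions (iota 0 n).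
    by move=> i; rewrite mem_iota add0n => /andP [_ /ltnW]; apply: dim_le_n.
  have vn : valid (iota 0 n) by split=> //; rewrite size_iota.
  have atn x : at_tuple (iota 0 n) x = x.
    by case: vn => sn _; have [_ _ e] := word_ofP sn dn; rewrite /at_tuple e.
  have f0 : f a <> zero B by rewrite -f_zero => /f_inj; case: aa.
  have fa : finitary (f a) by exists n; apply: f_Nr.
  have [lb [z [fz z0 le_z wz]]] := witnessed_exists dn fa f0.
  have wN : witnessed (Network (iota 0 n) lb) by split=> //; exists z.
  exists (Network (iota 0 n) lb); split=> //; split; first exact: witnessed_network.
  split; first exact: dn.
  have tn : tuple_in n (iota 0 n) (iota 0 n) by rewrite /tuple_in size_iota.
  exists (iota 0 n); split=> //=; have [al hl] := wz _ tn.
  by apply: (witnessed_label_eq vn z0) => //; rewrite atn.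
case=> lt; set N := nth _ prev t => -[ln [sg [gN [kg [dk [ab [x [xN le_b]]]]]]]].
have [dN [z [fz z0 wz]]] : witnessed N by apply: wp; apply: In_nth_net.
have tx := tuple_in_ins ln sg gN xN; have vx := valid_tuple dN tx.
have [ax hx] := wz _ tx.
have dM : dimensions (k :: nodes N) by move=> i; rewrite inE => /orP [/eqP ->|/dN].
have tk : tuple_in n (k :: nodes N) (ins l g k).
  by apply: tuple_in_ins; rewrite // ?inE ?eqxx // => i ig; rewrite inE gN ?orbT.
have vk := valid_tuple dM tk.
have dl : lt_dim l m by apply/dim_le_n/ltnW.
have nthk : nth 0 (ins l g k) l = k by rewrite (nth_ins _ _ ln sg) ltnn eqxx.
(* From [a <= cyl l b] for the old label [a], [z] lies below the value of [cyl l b] at the tuple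
   with [x]. This value is the same at the tuple with [k], where it is a cylinder over [k] because
   [k] occurs only once. *)
have z_le : le z (cyl B k (at_tuple (ins l g k) (f b))).
  rewrite -{1}nthk cyl_at_tuple //; last first.
    by move=> i li il; rewrite nthk; exact: (nth_ins_neq ln sg kg li il).
  rewrite (@at_tuple_eq _ (ins l g x) l) //.
  - apply: le_trans hx _; apply: at_tuple_mono => //; rewrite -f_cyl //.
    have /leE {1}<- := atom_cyl_sym ln ax ab le_b.
    by rewrite f_mul; apply: le_mulr.
  - exact: Nr_cyl.
  - exact: cyl_idem.
  - move=> i li il; rewrite !(nth_ins _ _ ln sg).
    by case: ltnP => // _; case: eqP.
pose z1 := mul B (cyl B k z) (at_tuple (ins l g k) (f b)).
(* The cylinder of [z1] over [k] is a product of two cylinders, both above [z]. *)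
have z10 : z1 <> zero B.
  move=> e; apply: z0; apply: le_zero; rewrite -(ca_C1 B dk) -e /z1.
  rewrite cyl_mul_fixl ?cyl_idem //; apply: le_mul => //; exact: cyl_ge.
have fz1 : finitary z1.
  by apply: finitary_mul; [apply: finitary_cyl | apply: finitary_at_tuple].
have [lb [z2 [fz2 z20 le_z2 wz2]]] := witnessed_exists dM fz1 z10.
have wM : witnessed (Network (k :: nodes N) lb) by split=> //; exists z2.
exists (Network (k :: nodes N) lb); split=> //; split; first exact: witnessed_network.
split; first exact: dM.
split; last split=> /=.
- move=> i /=; rewrite inE; split=> [/orP [/eqP|]|[|->]]; [by right|by left| |by rewrite eqxx].
  by move=> ->; rewrite orbT.
- move=> d td kd; have [al hl] := wz _ td; have vd := valid_tuple dN td.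
  have td' : tuple_in n (k :: nodes N) d.
    by case: td => sd dD; split=> // i /dD iN; rewrite inE iN orbT.
  have [al' hl'] := wz2 _ td'; apply: (witnessed_label_eq vd z20 al' al hl').
  apply: le_trans le_z2 _; apply: le_trans (le_mull _ _) _.
  (* The old bound on [z] does not depend on [k], so it also bounds [cyl B k z], and both labels of
     [d] hold below [z2]. *)
  rewrite -(@cyl_at_tuple_notin d k) //.
  exact: cyl_mono.
- have [al hl] := wz2 _ tk; apply: (witnessed_label_eq vk z20 al ab hl).
  exact: le_trans le_z2 (le_mulr _ _).
Qed.
End NeatReduct.

Theorem mainTheorem7 :
  (forall (n : nat) (m : dimension) (A : CA (Fin n)),
      2 <= n -> lt_dim n m -> atomic A ->
      ScNr n m A -> exists_wins_F A m) /\
  (forall (n : nat) (A : CA (Fin n)),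
      2 <= n -> atomic A -> countable A -> completely_representable A ->
      exists_wins_F A Omega).
Proof.
split=> [n m A _ nm atA [B [f]]|n A n2 atA _]; last exact: completely_representable_wins.
case=> f_inj [f_Nr [_ [f_mul [_ [f_zero [_ [f_cyl [f_diag f_sup]]]]]]]].
exact: (neat_reduct_wins nm atA f_inj f_Nr f_mul f_zero f_cyl f_diag f_sup).
Qed.
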